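(* Let $p>1$, let $N\ge 2$ be an integer, and set $\Lambda_p:=\left(\frac{N-1}{p}\right)^p$. There exist a bounded weight $V:\mathbb{H}^N\to\mathbb{R}$ with $0<V\le 1$ and a positive constant $C(N,p)$, depending only on $N$ and $p$, such that for all $u\in C_c^\infty(\mathbb{H}^N)$ $$\int_{\mathbb{H}^N}|\nabla_{\mathbb{H}^N}u|^p\,{\rm d}v_{\mathbb{H}^N}-\Lambda_p\int_{\mathbb{H}^N}|u|^p\,{\rm d}v_{\mathbb{H}^N}\ \ge\ \left(\frac{N-1}{p}\right)^{p-2}C(N,p)\int_{\mathbb{H}^N}V\,|u|^p\,{\rm d}v_{\mathbb{H}^N},$$ where $C(N,p)$ satisfies, with $p'=\frac{p}{p-1}$, $$C(N,p)\ge\frac{1}{4p'}\quad\text{if }1<p\le \tfrac43,$$ $$C(N,p)\ge\left(2(8-3p)+2\sqrt{p'(8-3p)}\right)^{-1}\quad\text{if }\tfrac43<p\le 2,$$ $$C(N,p)=\frac{1}{\sqrt2}\,\frac{1}{\sqrt2\,p+2\sqrt p}\quad\text{if }2<p\le 2(N-1)^2,$$ $$C(N,p)=\left(\frac{p}{N-1}+2p+2(N-1)\right)^{-1}\quad\text{if }p>2(N-1)^2.$$ Furthermore, for fixed $x_0\in\mathbb{H}^N$ and $r(x):=\varrho(x,x_0)$, one has: (i) for any $0<\alpha\le1$ there exists an unbounded set $U_\alpha\subset\mathbb{H}^N$ such that $V|_{U_\alpha}\equiv\alpha$ and $U_\alpha\cap\big(B(x_0,2R)\setminus B(x_0,R)\big)\ne\emptyset$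 for all sufficiently large $R$; (ii) for any $\beta>0$ there exists an unbounded set $W_\beta\subset\mathbb{H}^N$ such that $V|_{W_\beta}\sim\sqrt{\frac{\beta}{2}}\,e^{-r/2}$ as $r\to+\infty$, i.e. $V(x)\,e^{r(x)/2}\to\sqrt{\beta/2}$ as $r(x)\to+\infty$ with $x\in W_\beta$.
   Context: $\mathbb{H}^N$ is the hyperbolic space of dimension $N$ (constant sectional curvature $-1$); $\nabla_{\mathbb{H}^N}$ and ${\rm d}v_{\mathbb{H}^N}$ denote its Riemannian gradient and Riemannian measure, and $|\nabla_{\mathbb{H}^N}u|$ is the Riemannian norm of the gradient. $\varrho(x,x_0)$ is the geodesic distance between $x$ and $x_0$, and $B(x_0,R)$ is the geodesic ball of radius $R$ centered at $x_0$. *)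

(* Defs.v *)
From HB Require Import structures.
From mathcomp Require Import all_boot all_order all_algebra.
From mathcomp Require Import all_classical all_reals all_analysis.

Set Implicit Arguments.
Unset Strict Implicit.
Unset Printing Implicit Defensive.

Import Order.TTheory GRing.Theory Num.Theory.
Import numFieldNormedType.Exports.

Local Open Scope classical_set_scope.
Local Open Scope ring_scope.

(* Lebesgue measure on R^n, carried by n-tuples because row vectors have no
   measurable structure in the library: the Dirac mass for n = 0, then the image
   under tuple_cons of the product of the one-dimensional measure with the
   n-dimensional one. *)

Section lebesgue_step.
Context (R : realType) (n : nat).
Variable mu : {sigma_finite_measure set (n.-tuple (measurableTypeR R)) -> \bar R}.

Definition tuple_cons (z : measurableTypeR R * n.-tuple (measurableTypeR R)) :
    n.+1.-tuple (measurableTypeR R) :=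
  [tuple of z.1 :: z.2].

Lemma measurable_tuple_cons : measurable_fun [set: _] tuple_cons.
Proof. exact: measurable_cons measurable_fst measurable_snd. Qed.

Definition lebesgue_step : set (n.+1.-tuple (measurableTypeR R)) -> \bar R :=
  pushforward (@lebesgue_measure R \x mu)%E tuple_cons.

Let step0 : lebesgue_step set0 = 0%E.
Proof. by rewrite /lebesgue_step /pushforward preimage_set0 measure0. Qed.

Let step_ge0 A : (0 <= lebesgue_step A)%E.
Proof. exact: (measure_ge0 (@lebesgue_measure R \x mu)%E). Qed.

Let step_sigma_additive : semi_sigma_additive lebesgue_step.
Proof.
move=> F mF tF mUF; rewrite /lebesgue_step /pushforward preimage_bigcup.
apply: measure_semi_sigma_additive.
- by move=> k; rewrite -[X in measurable X]setTI; exact: measurable_tuple_cons.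
- apply/trivIsetP => /= i j _ _ ij; rewrite -preimage_setI.
  by move/trivIsetP : tF => /(_ _ _ _ _ ij) ->//; rewrite preimage_set0.
- by rewrite -preimage_bigcup -[X in measurable X]setTI;
     exact: measurable_tuple_cons.
Qed.

HB.instance Definition _ := isMeasure.Build _ _ _
  lebesgue_step step0 step_ge0 step_sigma_additive.

Let step_sigma_finite : sigma_finite setT lebesgue_step.
Proof.
have /sigma_finiteP[F [TF ndF Foo]] := sigma_finiteT (@lebesgue_measure R).
have /sigma_finiteP[G [TG ndG Goo]] := sigma_finiteT mu.
pose h (t : n.+1.-tuple (measurableTypeR R)) := (thead t, [tuple of behead t]).
have mh : measurable_fun [set: _] h.
  by apply/measurable_fun_pair; [exact: measurable_tnth|exact: measurable_behead].
have hK z : h (tuple_cons z) = z.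
  by case: z => a t; rewrite /h /tuple_cons theadE; congr pair; exact: val_inj.
exists (fun k => h @^-1` (F k `*` G k)) => [|k].
  rewrite -preimage_bigcup predeqE => t; split => // _.
  have [i _ Fi] : (\bigcup_k F k) (h t).1 by rewrite -TF.
  have [j _ Gj] : (\bigcup_k G k) (h t).2 by rewrite -TG.
  exists (maxn i j) => //; split.
  - by move: Fi; exact/subsetPset/ndF/leq_maxl.
  - by move: Gj; exact/subsetPset/ndG/leq_maxr.
have [mF Flt] := Foo k; have [mG Glt] := Goo k; split.
  by rewrite -[X in measurable X]setTI; apply: mh => //; exact: measurableX.
rewrite /lebesgue_step /pushforward -comp_preimage.
rewrite (_ : h \o tuple_cons = id); last by apply/funext => z /=; rewrite hK.
by rewrite preimage_id product_measure1E// lte_mul_pinfty// ge0_fin_numE.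
Qed.

HB.instance Definition _ := Measure_isSigmaFinite.Build _ _ _
  lebesgue_step step_sigma_finite.

End lebesgue_step.

Fixpoint lebesgueN (R : realType) (n : nat) :
    {sigma_finite_measure set (n.-tuple (measurableTypeR R)) -> \bar R} :=
  match n with
  | 0 => \d_([tuple] : 0.-tuple (measurableTypeR R))
  | m.+1 => lebesgue_step (lebesgueN R m)
  end.

Definition row_of_tuple (R : realType) n
  (t : n.-tuple (measurableTypeR R)) : 'rV[R]_n := \row_i tnth t i.

(* The upper half-space model, as an open subset of R^(n+1) carrying a
    Riemannian metric tensor.  Functions on hyperbolic space are total functions
    on 'rV[R]_n.+1 of which only the values on [halfspace] matter. *)

Section hyperbolic_space.
Context {R : realType} {n : nat}.
Implicit Types (x v w : 'rV[R]_n.+1) (u f V : 'rV[R]_n.+1 -> R).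

Definition halfspace : set 'rV[R]_n.+1 := [set x | 0 < x 0 ord_max].

Definition hmetric x : 'M[R]_n.+1 := ((x 0 ord_max) ^- 2)%:M.

Definition hnorm x v : R := Num.sqrt ((v *m hmetric x *m v^T) 0 0).

Definition hdiff u x : 'rV[R]_n.+1 := \row_i 'D_(delta_mx 0 i) u x.

(* the unique v with  v *m hmetric x *m w^T = du_x(w)  for all w *)
Definition hgrad u x : 'rV[R]_n.+1 := hdiff u x *m invmx (hmetric x).

Definition hintegral f : \bar R :=
  (\int[lebesgueN R n.+1]_(t in [set t | halfspace (row_of_tuple t)])
    (f (row_of_tuple t) * Num.sqrt (\det (hmetric (row_of_tuple t))))%:E)%E.

Definition hmeasurable f : Prop :=
  measurable_fun [set t : n.+1.-tuple (measurableTypeR R)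
                  | halfspace (row_of_tuple t)]
                 (fun t => f (row_of_tuple t)).

(* C^1 paths on [0, 1]; every such path extends to a C^1 map on the whole line,
   which avoids one-sided derivatives at the endpoints. *)
Definition hpath (x y : 'rV[R]_n.+1) (c : R -> 'rV[R]_n.+1) : Prop :=
  [/\ (forall t, derivable c t 1), continuous (fun t => 'D_1 c t),
      (forall t, 0 <= t <= 1 -> halfspace (c t)), c 0 = x & c 1 = y].

Definition hyp_length (c : R -> 'rV[R]_n.+1) : R :=
  \int[lebesgue_measure]_(t in `[0, 1]) hnorm (c t) ('D_1 c t).

Definition hdist (x y : 'rV[R]_n.+1) : R := inf [set hyp_length c | c in hpath x y].

Definition hball (x : 'rV[R]_n.+1) (r : R) : set 'rV[R]_n.+1 :=
  [set y | halfspace y /\ hdist y x < r].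

Definition hunbounded (A : set 'rV[R]_n.+1) : Prop :=
  forall x r, halfspace x -> ~ (A `<=` hball x r).

Definition partials (s : seq 'I_n.+1) u : 'rV[R]_n.+1 -> R :=
  foldr (fun i g x => 'D_(delta_mx 0 i) g x) u s.

(* Requiring the iterated partial derivatives of all orders to be (Frechet)
   differentiable is the same as requiring them to exist and be continuous. *)
Definition hsmooth u : Prop :=
  forall s x, halfspace x -> differentiable (partials s u) x.

Definition hcompact_support u : Prop :=
  exists K : set 'rV[R]_n.+1, [/\ compact K, K `<=` halfspace &
    forall x, halfspace x -> ~ K x -> u x = 0].

End hyperbolic_space.
Arguments halfspace : clear implicits.

(* Main.v *)
Require Import Defs.
From mathcomp Require Import all_boot all_order all_algebra.
From mathcomp Require Import all_classical all_reals all_analysis.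
From mathcomp Require Import measurable_realfun ring lra.
Set Implicit Arguments.
Unset Strict Implicit.
Unset Printing Implicit Defensive.
Import Order.TTheory GRing.Theory Num.Theory.
Import numFieldNormedType.Exports.
Local Open Scope classical_set_scope.
Local Open Scope ring_scope.

(** Write nu = N - 1, q = p / (p - 1), y for the last coordinate of the upper
    half-space, x1 for the first one, rho^2 = x1^2 + y^2, and e_N for the unit
    vector of the y axis.

    The inequality is a supersolution argument in divergence form.  If Y is a
    C^1 Euclidean vector field, the Euclidean divergence of y^(1-N) |u|^p Y
    integrates to 0; bounding the term with the gradient of u by Young's
    inequality [p U^(p-1) T g <= g^p + (p-1) T^q U^p] leaves
      int |grad u|^p >= int (y div Y - nu Y_N - (p-1) |Y|^q) |u|^p.
    The constant field Y = - a e_N with a = (nu/p)^(p-1) gives the factor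
    (nu/p)^p.  Now perturb it to
      Y = a (- e_N + k (x1 y, y^2) / rho^2),
    where the second term is k y times the gradient of log rho.  As log rho is
    harmonic in the (x1, y) plane, everything depends on V = y^2 / rho^2 alone:
      y div Y - nu Y_N = a (nu + k V - nu k V),
      |Y|^2 = a^2 (1 - (2 k - k^2) V).
    What remains is an inequality in one variable ([angular_profile]).  It holds
    with a gain of C (nu/p)^(p-2) V as soon as C <= 1/(2p) for p > 2, or
    C <= 1/(4 p') for p <= 2, and these two numbers dominate the prescribed
    constants ([Cnp_bounds]).  Lemma [pointwise_bound] is the resulting
    inequality between integrands, [weighted_poincare] the integrated one.

    The weight is V.  Its level sets {V = alpha} are cones |x1| = s y.  If x0 has
    height y0, the point of height y0 e^r on such a cone whose coordinates other
    than the first and the last are those of x0 is at distance between r and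
    r + O(1) from x0, which gives (i).  For (ii) the set W_beta is the level set
      {V e^(d/2) = sqrt (beta/2)},  d the distance to x0.
    It meets every vertical line x1 = L with L >= 1: near the boundary V decays
    like y^2 while e^(d/2) grows at most like y^(-1/2), and for y large V tends
    to 1 while d tends to infinity ([level_on_vertical]).  It is unbounded
    because log (1 + rho^2) is 2-Lipschitz for the hyperbolic distance
    ([hdist_ge_rho2]), so that points with L large are far away. *)

(** * Lebesgue measure on tuples and integration along coordinate lines *)

Lemma row_cvg {R : realType} {n : nat} {T : Type} {F : set_system T} {FF : Filter F}
    (c : T -> 'rV[R]_n) (l : 'rV[R]_n) :
  (forall i, c s 0 i @[s --> F] --> l 0 i) -> c s @[s --> F] --> l.
Proof.
move=> cl; apply/cvg_ballP => e e0.
have H : \forall s \near F, forall i, `|l 0 i - c s 0 i| < e.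
  apply: filter_forall => i; have /cvgrPdist_lt/(_ e e0) := cl i.
  exact: filterS.
near=> s; split => // i j; rewrite ord1.
have : forall i, `|l 0 i - c s 0 i| < e by near: s.
by move=> /(_ j).
Unshelve. all: by end_near. Qed.

(** Index of the cell of side 1 / (k + 1) that contains [t]. *)
Definition grid {R : realType} {n : nat} (k : nat)
    (t : n.-tuple (measurableTypeR R)) : {ffun 'I_n -> int} :=
  [ffun i => Num.floor (k.+1%:R * tnth t i)].

Lemma measurable_grid {R : realType} {n : nat} k (c : {ffun 'I_n -> int}) :
  measurable [set t : n.-tuple (measurableTypeR R) | grid k t = c].
Proof.
pose I i : set (measurableTypeR R) :=
  `[(c i)%:~R / k.+1%:R, (c i + 1)%:~R / k.+1%:R[%classic.
rewrite (_ : [set _ | _] = \bigcap_(i in [set: 'I_n]) ((fun t => tnth t i) @^-1` I i)).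
  apply: fin_bigcap_measurable => // i _.
  have mI : measurable (I i) by exact: measurable_itv.
  by have := @measurable_tnth _ (measurableTypeR R) n i measurableT _ mI; rewrite setTI.
apply/seteqP; split => t /=.
  move=> /ffunP tc i _ /=; rewrite /I/= in_itv/=.
  have := floor_itv (k.+1%:R * tnth t i); have := tc i; rewrite ffunE => ->.
  by rewrite ler_pdivrMr// ltr_pdivlMr// ![tnth t i * _]mulrC.
move=> tc; apply/ffunP => i; rewrite ffunE; apply: floor_def.
have := tc i Logic.I; rewrite /I /= in_itv/=.
by rewrite ler_pdivrMr// ltr_pdivlMr// ![tnth t i * _]mulrC.
Qed.

(** Row vectors carry no sigma-algebra, so continuity does not give
    measurability directly.  Instead [g] is the limit of its values at the
    corners of finer and finer grids, and each of these step functions is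
    constant on countably many measurable cells. *)
Lemma measurable_comp_row {R : realType} {n : nat} (g : 'rV[R]_n -> R) :
  continuous g ->
  measurable_fun [set: n.-tuple (measurableTypeR R)] (fun t => g (row_of_tuple t)).
Proof.
move=> cg.
pose r k (c : {ffun 'I_n -> int}) : 'rV[R]_n := \row_i ((c i)%:~R / k.+1%:R).
apply: (@measurable_realfun.measurable_fun_cvg _ _ _ setT (fun k t => g (r k (grid k t)))).
  move=> k _ Y _; rewrite setTI.
  rewrite (_ : _ @^-1` Y =
    \bigcup_(c in [set c | Y (g (r k c))]) [set t | grid k t = c]); last first.
    apply/seteqP; split => t /=; first by move=> Yt; exists (grid k t).
    by case=> c Yc tc; rewrite tc.
  rewrite bigcup_mkcond; apply: countable_bigcupT_measurable => //= c.
  by case: ifP => // _; exact: measurable_grid.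
move=> t _; apply: (@cvg_comp _ _ _ (fun k => r k (grid k t)) g _ _ _ _ (cg _)).
apply: row_cvg => i; rewrite mxE.
apply/cvgrPdist_le => e e0; near=> k; rewrite mxE ffunE.
have k0 : (0 : R) < k.+1%:R by [].
rewrite ger0_norm; last first.
  by rewrite subr_ge0 ler_pdivrMr// mulrC; exact: floor_le.
have /andP[_] := floor_itv (k.+1%:R * tnth t i).
rewrite intrD mulrC -ltr_pdivlMr// mulrDl mul1r => /ltW/le_trans; rewrite lerBlDl; apply.
rewrite lerD2l ltW//; near: k.
exact: (near_infty_natSinv_lt (PosNum e0)).
Unshelve. all: by end_near. Qed.

Lemma integrable_bounded_off {d} {T : measurableType d} {R : realType}
    (mu : {measure set T -> \bar R}) (A : set T) (f : T -> R) (B : R) :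
  measurable A -> (mu A < +oo)%E -> measurable_fun [set: T] f ->
  (forall x, `|f x| <= B) -> (forall x, ~ A x -> f x = 0) ->
  mu.-integrable [set: T] (EFin \o f).
Proof.
move=> mA Afin mf fB f0.
rewrite (_ : EFin \o f = (EFin \o f) \_ A); last first.
  apply/funext => x; rewrite patchE; case: ifPn => // /negP; rewrite inE => /f0 /= ->.
  by [].
apply/(integrable_mkcond _ mA)/measurable_bounded_integrable => //.
  exact: measurable_funTS.
exists B; split; first by rewrite num_real.
by move=> x Bx y _; rewrite /= (le_trans (fB y))// ltW.
Qed.

Definition box {R : realType} {n : nat} (M : R) : set (n.-tuple (measurableTypeR R)) :=
  [set t | forall i, `|tnth t i| <= M].

Lemma measurable_box {R : realType} {n : nat} (M : R) : measurable (@box R n M).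
Proof.
rewrite (_ : box M = \bigcap_(i in [set: 'I_n])
    ((fun t => tnth t i) @^-1` (`[- M, M]%classic : set (measurableTypeR R)))).
  apply: fin_bigcap_measurable => // i _.
  have mI : measurable (`[- M, M]%classic : set (measurableTypeR R)).
    exact: measurable_itv.
  by have := @measurable_tnth _ (measurableTypeR R) n i measurableT _ mI; rewrite setTI.
by apply/seteqP; split => t /= tM i => [_|]; have := tM i;
   rewrite /= in_itv/= -ler_norml// => /(_ Logic.I).
Qed.

Lemma tuple_cons_box {R : realType} {n : nat} (M : R) :
  @tuple_cons R n @^-1` box M = `[- M, M]%classic `*` box M.
Proof.
apply/seteqP; split => -[a t] /=.
  move=> H; split; first by have := H ord0; rewrite in_itv/= -ler_norml.
  by move=> i; have := H (lift ord0 i); rewrite tnthS.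
rewrite in_itv/= -ler_norml => -[aM tM] i.
by case: (unliftP ord0 i) => [j|] -> //; rewrite tnthS; exact: tM.
Qed.

Lemma lebesgueN_box_lty {R : realType} {n : nat} (M : R) :
  (lebesgueN R n (box M) < +oo)%E.
Proof.
elim: n => [|n IHn] /=; first by rewrite diracE ltry.
rewrite /lebesgue_step/= /pushforward tuple_cons_box product_measure1E//=.
  have fI : @lebesgue_measure R `[- M, M]%classic \is a fin_num.
    by rewrite lebesgue_measure_itv/=; case: ifP.
  by rewrite lte_mul_pinfty//.
exact: measurable_box.
Qed.

Definition tupd {R : realType} {n : nat} (t : n.-tuple R) (i : 'I_n) (s : R) :
    n.-tuple R :=
  [tuple if j == i then s else tnth t j | j < n].

Lemma tupd_cons0 {R : realType} {n : nat} (a s : R) (t : n.-tuple R) :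
  tupd (tuple_cons (a, t)) ord0 s = tuple_cons (s, t).
Proof.
apply: eq_from_tnth => j; rewrite tnth_mktuple.
case: (unliftP ord0 j) => [k ->|->] //.
by rewrite [RHS]tnthS tnthS.
Qed.

Lemma tupd_consS {R : realType} {n : nat} (a s : R) (t : n.-tuple R) (i : 'I_n) :
  tupd (tuple_cons (a, t)) (lift ord0 i) s = tuple_cons (a, tupd t i s).
Proof.
apply: eq_from_tnth => j; rewrite tnth_mktuple.
case: (unliftP ord0 j) => [k ->|->] //.
by rewrite [RHS]tnthS tnthS tnth_mktuple (inj_eq lift_inj).
Qed.

(** Fubini's theorem along an arbitrary coordinate.  The measure integrates the
    head of a tuple separately, so the induction peels off heads until the
    coordinate [i] is the head. *)
Lemma integral_lines0 {R : realType} {n : nat} (i : 'I_n)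
    (G : n.-tuple (measurableTypeR R) -> R) (M B : R) :
  measurable_fun [set: _] G -> (forall t, `|G t| <= B) ->
  (forall t, ~ box M t -> G t = 0) ->
  (forall t, \int[lebesgue_measure]_s (G (tupd t i s))%:E = 0)%E ->
  (\int[lebesgueN R n]_t (G t)%:E = 0)%E.
Proof.
elim: n i G => [|n IHn] i G mG GB G0 Gl; first by case: i {Gl}.
pose H z := (G (tuple_cons z))%:E.
have mH : measurable_fun [set: _] (G \o @tuple_cons R n).
  by apply: measurableT_comp => //; exact: measurable_tuple_cons.
have iH : (lebesgue_measure \x lebesgueN R n)%E.-integrable [set: _] H.
  apply: (@integrable_bounded_off _ _ _ _ (@tuple_cons R n @^-1` box M) _ B) => //.
  - rewrite tuple_cons_box; apply: measurableX => //.
    exact: measurable_box.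
  - exact: (@lebesgueN_box_lty R n.+1 M).
  - by move=> z zM /=; apply: G0.
transitivity (\int[lebesgue_measure \x lebesgueN R n]_z H z)%E.
  apply: (@integral_pushforward _ _ _ _ R _ (@measurable_tuple_cons R n)
    (lebesgue_measure \x lebesgueN R n)%E setT (EFin \o G)) => //.
  exact/measurable_realfun.measurable_EFinP.
case: (unliftP ord0 i) Gl => [j ->|->] Gl.
  rewrite -integral12_prod_meas1//; apply: integral0_eq => a _.
  apply: (IHn j (fun t => G (tuple_cons (a, t)))) => //.
  - by apply: (@measurableT_comp _ _ _ _ _ _ (G \o @tuple_cons R n)) => //; exact: measurable_pair1.
  - move=> t tM; apply: G0 => H1; apply: tM => k; have := H1 (lift ord0 k).
    by rewrite tnthS.
  - move=> t; rewrite -[RHS](Gl (tuple_cons (a, t))).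
    by apply: eq_integral => s _; rewrite tupd_consS.
rewrite -integral21_prod_meas1//; apply: integral0_eq => t _.
rewrite -[RHS](Gl (tuple_cons (0, t))).
by apply: eq_integral => s _; rewrite tupd_cons0.
Qed.

(** * Integration by parts for functions with compact support in the half-space *)

(** The fundamental theorem of calculus on an interval that contains the
    support. *)
Lemma integral_derive0 {R : realType} (phi gam : R -> R) (M : R) :
  (forall s : R, is_derive s (1 : R) phi (gam s)) -> continuous gam ->
  (forall s, M < `|s| -> phi s = 0) -> (forall s, M < `|s| -> gam s = 0) ->
  (\int[lebesgue_measure]_s (gam s)%:E = 0)%E.
Proof.
move=> dphi cgam phi0 gam0.
pose L := `|M| + 1.
have ML : M < L by rewrite /L ltr_pwDr// ler_norm.
have L0 : 0 < L by rewrite /L ltr_wpDl.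
have cphi : continuous phi.
  by move=> s; apply: differentiable_continuous; apply/derivable1_diffP; have [] := dphi s.
rewrite (_ : (fun s => (gam s)%:E) = (fun s => (gam s)%:E) \_ `[- L, L]); last first.
  apply/funext => s; rewrite patchE; case: ifPn => // /negP; rewrite inE/= in_itv/=.
  by rewrite -ler_norml => /negP; rewrite -ltNge => /(lt_trans ML)/gam0 ->.
rewrite -integral_mkcond (@continuous_FTC2 _ gam phi)//.
- by rewrite !phi0 ?subee// ?normrN gtr0_norm.
- by rewrite ltrNl (lt_trans _ L0)// oppr_lt0.
- exact: continuous_subspaceT.
- split; first by move=> s _; have [] := dphi s.
  + by apply: cvg_at_right_filter; exact: cphi.
  + by apply: cvg_at_left_filter; exact: cphi.
- by move=> s _; rewrite derive1E; have [_ ->] := dphi s.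
Qed.

Lemma is_derive_line {R : realType} {V : normedModType R} (f : V -> R)
    (b v : V) (s d : R) :
  is_derive (b + s *: v) v f d -> is_derive s (1 : R) (fun s => f (b + s *: v)) d.
Proof.
move=> [fx fd].
have E : (fun h : R => h^-1 *: ((f \o shift (b + s *: v)) (h *: v) - f (b + s *: v))) =
  (fun h : R => h^-1 *: (((fun s => f (b + s *: v)) \o shift s) (h *: (1 : R)) - f (b + s *: v))).
  apply/funext => h /=; congr (_ *: (f _ - _)).
  by rewrite [h *: 1]mulr1 scalerDl addrCA.
split; first by move: fx; rewrite /derivable E.
by move: fd; rewrite /derive E.
Qed.

Lemma near_eq_continuous {T U : topologicalType} (f g : T -> U) (x : T) :
  (\near x, f x = g x) -> {for x, continuous f} -> {for x, continuous g}.
Proof.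
move=> fg cf; rewrite /prop_for /continuous_at -(nbhs_singleton fg).
by apply: cvg_trans cf; exact: near_eq_cvg.
Qed.

Section compact_support.
Context {R : realType} {n : nat}.
Implicit Types (x : 'rV[R]_n.+1) (f F G : 'rV[R]_n.+1 -> R) (K : set 'rV[R]_n.+1).

Lemma open_halfspace : open (halfspace R n).
Proof.
by apply: (@open_comp _ _ (fun x : 'rV[R]_n.+1 => x 0 ord_max) [set y | 0 < y]);
  [move=> x _; exact: coord_continuous|exact: open_gt].
Qed.

Lemma ler_coord_norm (x : 'rV[R]_n.+1) i : `|x 0 i| <= `|x|.
Proof.
by rewrite [leRHS]mx_normrE; exact: (le_bigmax _ (fun ij => `|x ij.1 ij.2|) (0, i)).
Qed.

(** Only values on the half-space matter.  Functions with compact support in the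
    half-space stay regular when they are cut off outside it, and can then be
    handled as functions on the whole of Euclidean space. *)
Definition ext0 f x := if 0 < x 0 ord_max then f x else 0.

Lemma ext0E f x : halfspace R n x -> ext0 f x = f x.
Proof. by rewrite /ext0 /halfspace /= => ->. Qed.

Lemma near_ext0 f x : halfspace R n x -> \near x, f x = ext0 f x.
Proof.
move=> Hx; have : \forall y \near x, halfspace R n y.
  by apply: open_nbhs_nbhs; split => //; exact: open_halfspace.
by apply: filterS => y Hy; rewrite ext0E.
Qed.

Definition vanishes_off K f := forall x, halfspace R n x -> ~ K x -> f x = 0.

Lemma near_off K f x : compact K -> vanishes_off K f -> ~ K x ->
  \near x, 0 = ext0 f x.
Proof.
move=> cK f0 Kx; have : \forall y \near x, (~` K) y.
  apply: open_nbhs_nbhs; split => //; apply: closed_openC.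
  by apply: compact_closed => //; exact: norm_hausdorff.
by apply: filterS => y Ky; rewrite /ext0; case: ifPn => // Hy; rewrite f0.
Qed.

(** The half-space and the complement of [K] are open and cover everything; on
    the first the cut-off function is [f], on the second it is 0. *)
Lemma ext0_continuous K f : compact K -> K `<=` halfspace R n ->
  vanishes_off K f -> (forall x, halfspace R n x -> {for x, continuous f}) ->
  continuous (ext0 f).
Proof.
move=> cK KH f0 cf x; have [/KH Kx|Kx] := pselect (K x).
  exact: near_eq_continuous (near_ext0 f Kx) (cf x Kx).
by apply: near_eq_continuous (near_off cK f0 Kx) _; exact: cst_continuous.
Qed.

Lemma derive_vanishes_off K F G i : compact K -> K `<=` halfspace R n ->
  vanishes_off K F ->
  (forall x, halfspace R n x -> is_derive x (delta_mx 0 i) F (G x)) ->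
  vanishes_off K G.
Proof.
move=> cK KH F0 dF x Hx Kx; have [_ <-] := dF x Hx.
have nx := near_off cK F0 Kx.
have nF : \near x, cst 0 x = F x.
  by near=> y; rewrite (near (near_ext0 F Hx) y)// -(near nx y).
by rewrite -(near_eq_derive _ nF) derive_cst.
Unshelve. all: by end_near. Qed.

Lemma ext0_derive K F G i : compact K -> K `<=` halfspace R n ->
  vanishes_off K F ->
  (forall x, halfspace R n x -> is_derive x (delta_mx 0 i) F (G x)) ->
  forall x, is_derive x (delta_mx 0 i) (ext0 F) (ext0 G x).
Proof.
move=> cK KH F0 dF x; have [/KH Kx|Kx] := pselect (K x).
  by rewrite ext0E//; apply: near_eq_is_derive (dF x Kx); exact: near_ext0.
have -> : ext0 G x = 0.
  rewrite /ext0; case: ifPn => // Hx.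
  exact: derive_vanishes_off cK KH F0 dF _ Hx Kx.
by apply: near_eq_is_derive (near_off cK F0 Kx) _; exact: is_derive_cst.
Qed.

Local Notation D := [set t : n.+1.-tuple (measurableTypeR R) | halfspace R n (row_of_tuple t)].

Lemma measurable_halfspace : measurable D.
Proof.
rewrite (_ : D = (fun t : n.+1.-tuple (measurableTypeR R) => tnth t ord_max) @^-1`
    (`]0, +oo[%classic : set (measurableTypeR R))); last first.
  by apply/seteqP; split => t /=; rewrite /halfspace/= mxE in_itv/= andbT.
have mI : measurable (`]0, +oo[%classic : set (measurableTypeR R)).
  exact: measurable_itv.
by have := @measurable_tnth _ (measurableTypeR R) n.+1 ord_max measurableT _ mI; rewrite setTI.
Qed.

Lemma ext0_off K f x : vanishes_off K f -> ~ K x -> ext0 f x = 0.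
Proof. by move=> f0 Kx; rewrite /ext0; case: ifPn => // Hx; rewrite f0. Qed.

Lemma ext0_bounded K f : compact K -> vanishes_off K f -> continuous (ext0 f) ->
  exists B, forall x, `|ext0 f x| <= B.
Proof.
move=> cK f0 cf.
have /compact_bounded[B [_ HB]] : compact (ext0 f @` K).
  by apply: continuous_compact => //; exact: continuous_subspaceT.
exists (`|B| + 1) => x; have [Kx|Kx] := pselect (K x).
  by apply: HB; [rewrite ltr_pwDr// ler_norm|exists x].
by rewrite (ext0_off f0 Kx) normr0 addr_ge0.
Qed.

Lemma compact_in_box K : compact K ->
  exists M : R, forall x, K x -> forall i, `|x 0 i| <= M.
Proof.
move=> /compact_bounded[B [_ HB]]; exists (`|B| + 1) => x Kx i.
rewrite (le_trans (ler_coord_norm x i))//; apply: HB => //.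
by rewrite ltr_pwDr// ler_norm.
Qed.

Lemma integral_ext0 f :
  (\int[lebesgueN R n.+1]_(t in D) (f (row_of_tuple t))%:E =
   \int[lebesgueN R n.+1]_t (ext0 f (row_of_tuple t))%:E)%E.
Proof.
rewrite integral_mkcond; apply: eq_integral => t _.
rewrite patchE /ext0 /=; case: ifPn => [|/negP]; rewrite inE /halfspace /=.
  by move=> ->.
by move=> /negP/negbTE ->.
Qed.

Lemma ext0_integrable K f : compact K -> vanishes_off K f ->
  continuous (ext0 f) ->
  (lebesgueN R n.+1).-integrable [set: _] (fun t => (ext0 f (row_of_tuple t))%:E).
Proof.
move=> cK f0 cf; have [B fB] := ext0_bounded cK f0 cf; have [M KM] := compact_in_box cK.
apply: (@integrable_bounded_off _ _ _ _ (box M) (fun t => ext0 f (row_of_tuple t)) B) => //.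
- exact: measurable_box.
- exact: lebesgueN_box_lty.
- exact: measurable_comp_row.
- move=> t tM; apply: (ext0_off f0) => Kt; apply: tM => i.
  by have := KM _ Kt i; rewrite mxE.
Qed.

Lemma tame_integrable K f : compact K -> K `<=` halfspace R n ->
  vanishes_off K f -> (forall x, halfspace R n x -> {for x, continuous f}) ->
  (lebesgueN R n.+1).-integrable D (fun t => (f (row_of_tuple t))%:E).
Proof.
move=> cK KH f0 cf; have ce := ext0_continuous cK KH f0 cf.
apply: (@eq_integrable _ _ _ _ _ measurable_halfspace (fun t => (ext0 f (row_of_tuple t))%:E)).
  by move=> t; rewrite inE => Ht; rewrite ext0E.
apply: integrableS (ext0_integrable cK f0 ce) => //.
exact: measurable_halfspace.
Qed.

Lemma row_tupd (t : n.+1.-tuple R) i s :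
  row_of_tuple (tupd t i s) = row_of_tuple (tupd t i 0) + s *: delta_mx 0 i.
Proof.
apply/rowP => j; rewrite !mxE !tnth_mktuple eqxx/=.
by case: eqP => _ /=; rewrite ?mulr1 ?add0r ?mulr0 ?addr0.
Qed.

(** The divergence theorem for one component, without boundary term: on each line
    parallel to the i-th axis the cut-off of [F] has compact support. *)
Lemma integral_partial0 K F G i : compact K -> K `<=` halfspace R n ->
  vanishes_off K F ->
  (forall x, halfspace R n x -> is_derive x (delta_mx 0 i) F (G x)) ->
  (forall x, halfspace R n x -> {for x, continuous G}) ->
  (\int[lebesgueN R n.+1]_(t in D) (G (row_of_tuple t))%:E = 0)%E.
Proof.
move=> cK KH F0 dF cG; rewrite integral_ext0.
have G0 := derive_vanishes_off cK KH F0 dF.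
have ceG := ext0_continuous cK KH G0 cG.
have [B GB] := ext0_bounded cK G0 ceG; have [M KM] := compact_in_box cK.
apply: (@integral_lines0 _ _ i (fun t => ext0 G (row_of_tuple t)) M B) => //.
- exact: measurable_comp_row.
- move=> t tM; apply: (ext0_off G0) => Kt; apply: tM => j.
  by have := KM _ Kt j; rewrite mxE.
move=> t; pose b := row_of_tuple (tupd t i 0).
have offK s : M < `|s| -> ~ K (b + s *: delta_mx 0 i).
  move=> Ms Ks; move: Ms; rewrite ltNge => /negP; apply.
  by have := KM _ Ks i; rewrite !mxE !tnth_mktuple !eqxx/= mulr1 add0r.
under eq_integral do rewrite row_tupd.
apply: (@integral_derive0 _ (fun s => ext0 F (b + s *: delta_mx 0 i))
   (fun s => ext0 G (b + s *: delta_mx 0 i)) M).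
- by move=> s; apply: is_derive_line; exact: (ext0_derive cK KH F0 dF).
- move=> s; have c1 : {for s, continuous (fun s : R => b + s *: delta_mx 0 i)}.
    by apply: cvgD; [exact: cvg_cst|exact: scalel_continuous].
  exact: (continuous_comp c1 (ceG _)).
- by move=> s Ms; exact: ext0_off F0 (offK _ Ms).
- by move=> s Ms; exact: ext0_off G0 (offK _ Ms).
Qed.

End compact_support.

(** * Scalar inequalities and the constants *)

Section scalar.
Context {R : realType}.
Implicit Types (p q r s x m : R).

(** Young's inequality against the constant 1: a concave power lies below its
    tangent at 1. *)
Lemma powR_le_tangent s x : 0 < s -> s <= 1 -> 0 <= x -> x `^ s <= 1 + s * (x - 1).
Proof.
move=> s0; rewrite le_eqVlt => /predU1P[->|s1] x0.
  by rewrite powRr1// mul1r subrKC.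
have t0 : 0 < 1 - s by rewrite subr_gt0.
have := @conjugate_powR _ (x `^ s) 1 s^-1 (1 - s)^-1.
rewrite powR_ge0 ler01 !invr_gt0 s0 t0 !invrK subrKC mulr1 powR1 mul1r -powRrM.
rewrite mulfV ?gt_eqF// powRr1// => /(_ isT isT isT isT erefl)/le_trans; apply.
by rewrite le_eqVlt; apply/orP; left; apply/eqP; ring.
Qed.

Lemma powR_ge_tangent r x : 1 <= r -> 0 <= x -> 1 + r * (x - 1) <= x `^ r.
Proof.
move=> r1 x0; have r0 : 0 < r by rewrite (lt_le_trans _ r1).
have := @powR_le_tangent r^-1 (x `^ r); rewrite invr_gt0 r0 invf_le1// r1 powR_ge0.
rewrite -powRrM mulfV ?gt_eqF// powRr1// => /(_ isT isT isT).
rewrite -lerBlDl ler_pdivlMl// => H; lra.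
Qed.

(** The tangent bound from below, taken at 1 / (1 - m), bounds the power at
    1 - m from above by a rational function, which is then expanded to second
    order.  This replaces Taylor's formula. *)
Lemma powR1B_le r m : 1 <= r -> 0 <= m <= 1 ->
  (1 - m) `^ r <= 1 - r * m + r * (r - 1) * m ^+ 2.
Proof.
move=> r1 /andP[m0]; have r0 : 0 < r by rewrite (lt_le_trans _ r1).
rewrite le_eqVlt => /predU1P[->|m1].
  rewrite subrr powR0 ?gt_eqF//; have := sqr_ge0 (r - 1); nra.
have d0 : 0 < 1 - m by rewrite subr_gt0.
have e0 : 0 < 1 + (r - 1) * m by rewrite ltr_pwDl// mulr_ge0// subr_ge0.
have H : (1 + (r - 1) * m) / (1 - m) <= ((1 - m) `^ r)^-1.
  have := @powR_ge_tangent r (1 - m)^-1 r1; rewrite invr_ge0 ltW// => /(_ isT).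
  have -> : (1 - m)^-1 `^ r = ((1 - m) `^ r)^-1.
    by rewrite -powR_inv1 ?ltW// -powRrM mulN1r powRN.
  apply: le_trans; rewrite le_eqVlt; apply/orP; left; apply/eqP; field.
  by rewrite gt_eqF.
have P0 : 0 < (1 - m) `^ r by exact: powR_gt0.
have : (1 - m) `^ r <= (1 - m) / (1 + (r - 1) * m).
  by rewrite -[leLHS]invrK -[leRHS]invf_div lef_pV2 ?posrE ?invr_gt0 ?divr_gt0.
move/le_trans; apply; rewrite ler_pdivrMr//.
have : 0 <= r * (r - 1) ^+ 2 * m ^+ 3.
  by rewrite mulr_ge0 ?exprn_ge0// mulr_ge0 ?sqr_ge0 ?ltW.
move=> H0; rewrite -subr_ge0 (le_trans H0)// le_eqVlt; apply/orP; left; apply/eqP; ring.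
Qed.

Lemma young_powR p q (g U T : R) : 1 < p -> p^-1 + q^-1 = 1 ->
  0 <= g -> 0 <= U -> 0 <= T ->
  p * U `^ (p - 1) * T * g <= g `^ p + (p - 1) * T `^ q * U `^ p.
Proof.
move=> p1 pq g0 U0 T0.
have p0 : 0 < p by rewrite (lt_trans _ p1).
have p10 : 0 < p - 1 by rewrite subr_gt0.
have qE : q = p / (p - 1).
  have : q^-1 = (p - 1) / p by rewrite mulrBl divff ?gt_eqF// div1r -pq addrAC subrr add0r.
  by move/(congr1 GRing.inv); rewrite invrK invf_div.
have q0 : 0 < q by rewrite qE divr_gt0.
have := @conjugate_powR _ g (T * U `^ (p - 1)) p q g0 (mulr_ge0 T0 (powR_ge0 _ _)) p0 q0 pq.
have qp : (p - 1) * q = p by rewrite qE mulrC divfK ?gt_eqF.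
rewrite powRM ?powR_ge0// -powRrM qp -(ler_pM2l p0).
have -> : p * (g `^ p / p + T `^ q * U `^ p / q) = g `^ p + (p - 1) * T `^ q * U `^ p.
  by rewrite qE; field; rewrite !gt_eqF.
by apply: le_trans; rewrite le_eqVlt; apply/orP; left; apply/eqP; ring.
Qed.
End scalar.

Section constants.
Context {R : realType}.
Implicit Types (p nu C k t : R).

(** The gain in [angular_profile] for the best [k]; for p <= 2 it equals
    1 / (4 p'). *)
Definition Cmax p : R := if p <= 2 then (p - 1) / (4 * p) else (2 * p)^-1.

(** Here [t] stands for the value of the weight, and [nu] for N - 1.  Expanding
    the power to second order, the right-hand side is at least
    k t - K k^2 t with K = nu / 2 for p > 2 and K = nu (q - 1) for p <= 2, where
    q = p / (p - 1); the best choice is k = 1 / (2 K), with gain k t / 2. *)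
Lemma angular_profile p nu C : 1 < p -> 1 <= nu -> C <= Cmax p ->
  exists k, [/\ 0 <= k, k <= 1 & forall t, 0 <= t <= 1 ->
    C * p / nu * t <= k * t - nu * k * t
      + nu * ((p - 1) / p) * (1 - (1 - (2 * k - k ^+ 2) * t) `^ (p / (p - 1) / 2))].
Proof.
move=> p1 nu1 Cp; have p0 : 0 < p by rewrite (lt_trans _ p1).
have p10 : 0 < p - 1 by rewrite subr_gt0.
have nu0 : 0 < nu by rewrite (lt_le_trans _ nu1).
pose q := p / (p - 1).
have q0 : 0 < q by rewrite divr_gt0.
have qV : (p - 1) / p = q^-1 by rewrite invf_div.
have mI k t : 0 <= k -> k <= 1 -> 0 <= t <= 1 -> 0 <= (2 * k - k ^+ 2) * t <= 1.
  move=> k0 k1 /andP[t0 t1].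
  have h0 : 0 <= 2 * k - k ^+ 2 by rewrite subr_ge0 expr2 ler_wpM2r// (le_trans k1)// ler1n.
  have h1 : 2 * k - k ^+ 2 <= 1 by have := sqr_ge0 (1 - k); lra.
  by rewrite mulr_ge0//= mulr_ile1.
move: Cp; rewrite /Cmax qV -/q; case: ifPn => [p2|]; last rewrite -ltNge => p2.
  (* this is 1 / (2 nu (q - 1)), as q - 1 = 1 / (p - 1) *)
  move=> Cp; exists ((p - 1) / (2 * nu)).
  set k := _ / (2 * nu).
  have k0 : 0 <= k by rewrite divr_ge0 ?ltW// mulr_gt0.
  have k1 : k <= 1 by rewrite ler_pdivrMr ?mulr_gt0//; lra.
  have q2 : 2 <= q by rewrite ler_pdivlMr//; lra.
  split => // t t01; have mt := mI k t k0 k1 t01.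
  case/andP : (t01) => t0 t1.
  have := @powR1B_le _ (q / 2) _ _ mt; rewrite ler_pdivlMr// mul1r => /(_ q2).
  set P := _ `^ _; pose m := (2 * k - k ^+ 2) * t; rewrite -/m in mt *.
  move=> PH.
  have mle : m ^+ 2 <= 4 * k ^+ 2 * t.
    have -> : m ^+ 2 = (2 - k) ^+ 2 * k ^+ 2 * t ^+ 2 by rewrite /m; ring.
    have kk := mulr_ge0 (sqr_ge0 k) t0.
    have h1 : (2 - k) ^+ 2 <= 4 by have := mulr_ge0 k0 k0; nra.
    have h2 : k ^+ 2 * t ^+ 2 <= k ^+ 2 * t by rewrite ler_wpM2l ?sqr_ge0// expr2 ler_piMl.
    by rewrite -mulrA -[leRHS]mulrA ler_pM ?sqr_ge0// mulr_ge0 ?sqr_ge0.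
  have H1 : q / 2 * (q / 2 - 1) * m ^+ 2 <= q * (q - 2) * k ^+ 2 * t.
    have q20 : 0 <= q / 2 * (q / 2 - 1).
      by apply: mulr_ge0; lra.
    have := ler_wpM2l q20 mle; move=> /le_trans; apply.
    by rewrite le_eqVlt; apply/orP; left; apply/eqP; field.
  have H2 : q^-1 * (1 - P) >= k * t - k ^+ 2 * t / 2 - (q - 2) * k ^+ 2 * t.
    rewrite ler_pdivlMl//; apply: le_trans (_ : q / 2 * m - q / 2 * (q / 2 - 1) * m ^+ 2 <= _); last by lra.
    apply: le_trans (lerB (lexx _) H1); rewrite /m.
    by rewrite le_eqVlt; apply/orP; left; apply/eqP; field.
  have H3 := ler_wpM2l (ltW nu0) H2.
  have E : (q - 1) * (nu * k) = 2^-1.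
    by rewrite /q /k; field; rewrite !gt_eqF.
  have H4 : C * p / nu * t <= k / 2 * t.
    rewrite ler_wpM2r// ler_pdivrMr//.
    have -> : k / 2 * nu = (p - 1) / (4 * p) * p by rewrite /k; field; rewrite !gt_eqF.
    by rewrite ler_wpM2r// ltW.
  have H5 : nu * k ^+ 2 * t * (q - 1) = k / 2 * t.
    have -> : nu * k ^+ 2 * t * (q - 1) = (q - 1) * (nu * k) * (k * t) by ring.
    by rewrite E; field.
  have H6 := mulr_ge0 (mulr_ge0 (ltW nu0) (sqr_ge0 k)) t0.
  rewrite -[X in _ + X]mulrA; apply: (le_trans H4).
  apply: le_trans (lerD (lexx _) H3).
  rewrite [leRHS](_ : _ = k * t - nu * k ^+ 2 * t * (q - 1) + nu * k ^+ 2 * t / 2).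
    by rewrite H5; lra.
  by field.
move=> Cp; exists nu^-1.
have k0 : 0 <= nu^-1 by rewrite invr_ge0 ltW.
have k1 : nu^-1 <= 1 by rewrite invf_le1.
split => // t t01; have /andP[m0 m1] := mI _ t k0 k1 t01.
case/andP : (t01) => t0 t1.
have qr : q / 2 <= 1 by rewrite /q -mulrA -invfM ler_pdivrMr ?mulr_gt0//; lra.
have := @powR_le_tangent _ (q / 2) (1 - (2 * nu^-1 - nu^-1 ^+ 2) * t).
rewrite divr_gt0// subr_ge0 m1 => /(_ isT qr isT).
set P := _ `^ _ => PH.
have H2 : q^-1 * (1 - P) >= (2 * nu^-1 - nu^-1 ^+ 2) * t / 2.
  by rewrite ler_pdivlMl//; lra.
have H3 := ler_wpM2l (ltW nu0) H2.
have H4 : C * p / nu * t <= nu^-1 / 2 * t.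
  rewrite ler_wpM2r// ler_pdivrMr//.
  have -> : nu^-1 / 2 * nu = (2 * p)^-1 * p by field; rewrite !gt_eqF.
  by rewrite ler_wpM2r// ltW.
rewrite -[X in _ + X]mulrA; apply: (le_trans H4).
apply: le_trans (lerD (lexx _) H3).
by rewrite le_eqVlt; apply/orP; left; apply/eqP; field; rewrite gt_eqF.
Qed.

Definition Cnp (N p : R) : R :=
  if p <= 4 / 3 then (4 * (p / (p - 1)))^-1
  else if p <= 2 then
    (2 * (8 - 3 * p) + 2 * Num.sqrt (p / (p - 1) * (8 - 3 * p)))^-1
  else if p <= 2 * (N - 1) ^+ 2 then
    (Num.sqrt 2)^-1 * (Num.sqrt 2 * p + 2 * Num.sqrt p)^-1
  else (p / (N - 1) + 2 * p + 2 * (N - 1))^-1.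

(** Only the second range needs thought: there w = 8 - 3 p satisfies w >= p',
    because (3 p - 4) (2 - p) >= 0, and hence 2 w + 2 sqrt (p' w) >= 4 p'. *)
Lemma Cnp_bounds N p : 1 < N -> 1 < p -> 0 < Cnp N p <= Cmax p.
Proof.
move=> N1 p1; have p0 : 0 < p by rewrite (lt_trans _ p1).
have p10 : 0 < p - 1 by rewrite subr_gt0.
have N10 : 0 < N - 1 by rewrite subr_gt0.
have q0 : 0 < p / (p - 1) by rewrite divr_gt0.
have qE : (p - 1) / (4 * p) = (4 * (p / (p - 1)))^-1.
  by field; rewrite !gt_eqF.
rewrite /Cnp /Cmax; case: ifPn => [p43|].
  have p2 : p <= 2 by lra.
  by rewrite p2 qE lexx invr_gt0 mulr_gt0.
rewrite -ltNge => p43; case: ifPn => [p2|].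
  set w := 8 - 3 * p; have wq : p / (p - 1) <= w.
    rewrite ler_pdivrMr// /w.
    have : 0 <= (3 * p - 4) * (2 - p) by rewrite mulr_ge0//; lra.
    by lra.
  have w0 : 0 < w by rewrite (lt_le_trans _ wq).
  have sq : p / (p - 1) <= Num.sqrt (p / (p - 1) * w).
    apply: (@le_trans _ _ (Num.sqrt ((p / (p - 1)) ^+ 2))).
      by rewrite sqrtr_sqr gtr0_norm.
    by apply: ler_wsqrtr; rewrite expr2 ler_wpM2l// ltW.
  have d0 : 0 < 2 * w + 2 * Num.sqrt (p / (p - 1) * w).
    by rewrite ltr_pwDl ?mulr_gt0// mulr_ge0// sqrtr_ge0.
  have q4 : 0 < 4 * (p / (p - 1)) by rewrite mulr_gt0.
  by rewrite invr_gt0 d0/= qE lef_pV2 ?posrE//; lra.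
rewrite -ltNge => p2; case: ifPn => _.
  have s2 : 0 < Num.sqrt 2 :> R by rewrite sqrtr_gt0.
  have sp : 0 < Num.sqrt p by rewrite sqrtr_gt0.
  rewrite -invfM invr_gt0 !mulr_gt0 ?addr_gt0 ?mulr_gt0//=.
  rewrite lef_pV2 ?posrE ?mulr_gt0 ?addr_gt0 ?mulr_gt0//.
  rewrite mulrDr mulrA -expr2 sqr_sqrtr// lerDl !mulr_ge0// ltW//.
have h := divr_gt0 p0 N10.
have d0 : 0 < p / (N - 1) + 2 * p + 2 * (N - 1) by lra.
have p20 : 0 < 2 * p by rewrite mulr_gt0.
by rewrite invr_gt0 d0/= lef_pV2 ?posrE//; lra.
Qed.

End constants.

(** * The p-th power of the absolute value *)

Section normpow.
Context {R : realType}.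
Implicit Types (a p z : R).

Lemma continuous_normpow a : 0 < a -> continuous (fun z : R => `|z| `^ a).
Proof.
move=> a0 z; have [->|z0] := eqVneq z 0.
  apply/cvgrPdist_lt => e e0; rewrite normr0 powR0 ?gt_eqF//.
  near=> y; rewrite sub0r normrN ger0_norm ?powR_ge0//.
  have -> : e = (e `^ a^-1) `^ a by rewrite -powRrM mulVf ?gt_eqF// powRr1// ltW.
  apply: gt0_ltr_powR => //; rewrite ?nnegrE ?powR_ge0//.
  by near: y; apply: (@pseudometric_normed_Zmodule.nbhs0_lt _ R^o); exact: powR_gt0.
rewrite /prop_for /continuous_at.
apply: (@continuous_comp _ _ _ (fun z : R => `|z|) (fun z => z `^ a)).
  exact: norm_continuous.
apply: differentiable_continuous; apply/derivable1_diffP; apply: derivable_powR.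
by rewrite in_itv/= andbT normr_gt0.
Unshelve. all: by end_near. Qed.

(** The derivative of [z |-> |z|^p]. *)
Definition dnormpow p z := p * (Num.sg z * `|z| `^ (p - 1)).

Lemma near_sg z : z != 0 -> \forall y \near z, Num.sg z = Num.sg y.
Proof.
move=> z0; have [zpos|zneg|/eqP] := ltgtP z 0; last by rewrite (negbTE z0).
- near=> y; rewrite !ltr0_sg//; near: y; exact: lt_nbhsl.
- near=> y; rewrite !gtr0_sg//; near: y; exact: lt_nbhsr.
Unshelve. all: by end_near. Qed.

Lemma continuous_dnormpow p : 1 < p -> continuous (dnormpow p).
Proof.
move=> p1 z; have p0 : 0 < p by rewrite (lt_trans _ p1).
have p10 : 0 < p - 1 by rewrite subr_gt0.
have cn := @continuous_normpow _ p10.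
have cpn : continuous (fun z : R => p * `|z| `^ (p - 1)).
  by move=> y; apply: cvgMl_tmp; exact: cn.
have [->|z0] := eqVneq z 0.
  have := cpn 0; rewrite /continuous_at normr0 powR0 ?gt_eqF// mulr0 => c0.
  apply/cvgrPdist_lt => e e0; move/cvgr0_norm_lt : c0 => /(_ e e0) c0; near=> y.
  rewrite {1}/dnormpow sgr0 mul0r mulr0 sub0r normrN.
  apply: (@le_lt_trans _ _ `|p * `|y| `^ (p - 1)|).
    rewrite /dnormpow !normrM ler_wpM2l// ler_piMl// normr_sg.
    by case: (y != 0).
  by near: y; exact: c0.
have cs : continuous (fun y : R => p * Num.sg z * `|y| `^ (p - 1)).
  by move=> y; apply: cvgMl_tmp; exact: cn.
have nE : \forall y \near z, p * Num.sg z * `|y| `^ (p - 1) = dnormpow p y.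
  by have := near_sg z0; apply: filterS => y e; rewrite /dnormpow e mulrA.
exact: near_eq_continuous nE (cs z).
Unshelve. all: by end_near. Qed.

Lemma is_derive_normpow p z : 1 < p ->
  is_derive z (1 : R) (fun z => `|z| `^ p) (dnormpow p z).
Proof.
move=> p1; have p0 : 0 < p by rewrite (lt_trans _ p1).
have p10 : 0 < p - 1 by rewrite subr_gt0.
have [zneg|zpos|->] := ltgtP z 0.
- have -> : dnormpow p z = p * (- z) `^ (p - 1) * -1.
    by rewrite /dnormpow ltr0_sg// ltr0_norm//; ring.
  apply: (@near_eq_is_derive _ _ _ ((fun z => z `^ p) \o (fun z => - z))).
    near=> y; rewrite /= ltr0_norm//; near: y; exact: lt_nbhsl.
  apply: is_derive1_comp; apply: is_derive1_powR; by rewrite oppr_gt0.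
- have -> : dnormpow p z = p * z `^ (p - 1).
    by rewrite /dnormpow gtr0_sg// gtr0_norm// mul1r.
  apply: (@near_eq_is_derive _ _ _ (fun z => z `^ p)).
    near=> y; rewrite /= gtr0_norm//; near: y; exact: lt_nbhsr.
  exact: is_derive1_powR.
- have -> : dnormpow p 0 = 0 by rewrite /dnormpow sgr0 mul0r mulr0.
  have H : h^-1 *: (((fun z : R => `|z| `^ p) \o shift (0 : R)) (h *: (1 : R)) - `|0 : R| `^ p)
      @[h --> (0 : R)^'] --> (0 : R).
    apply/cvgrPdist_lt => e e0; near=> h.
    have h0 : h != 0 by near: h; exact: nbhs_dnbhs_neq.
    have hn : 0 < `|h| by rewrite normr_gt0.
    rewrite sub0r normrN /= addr0 [h *: 1]mulr1 normr0 powR0 ?gt_eqF// subr0.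
    rewrite normrZ [X in _ * X]ger0_norm ?powR_ge0// normfV -mulr_powRB1//.
    rewrite mulKf ?gt_eqF//.
    near: h; apply: cvg_within.
    have := @continuous_normpow _ p10 0; rewrite /continuous_at normr0 powR0 ?gt_eqF//.
    move=> /cvgr0_norm_lt/(_ e e0); apply: filterS => y.
    by rewrite ger0_norm ?powR_ge0.
  split; first by apply/cvg_ex; exists 0; exact: H.
  exact: cvg_lim H.
Unshelve. all: by end_near. Qed.

End normpow.

(** * The weight and the vector field *)

(** A directional derivative may be computed on the line through the point,
    where the calculus of one variable applies. *)
Lemma is_derive_of_line {R : realType} {V : normedModType R} (f : V -> R)
    (x v : V) (d : R) :
  is_derive (0 : R) (1 : R) (fun s => f (x + s *: v)) d -> is_derive x v f d.
Proof.
have E : (fun h : R => h^-1 *: ((f \o shift x) (h *: v) - f x)) =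
  (fun h : R => h^-1 *: (((fun s => f (x + s *: v)) \o shift (0 : R)) (h *: (1 : R)) - f (x + 0 *: v))).
  apply/funext => h; rewrite scale0r addr0; congr (_ *: (f _ - _)).
  by rewrite /= addr0 [h *: 1]mulr1 addrC.
move=> [fx fd]; split; first by rewrite /derivable E.
by rewrite /derive E.
Qed.

Lemma is_derive_compR {R : realType} {V : normedModType R} (f : R -> R) (g : V -> R)
    (x v : V) (a b : R) :
  is_derive (g x) (1 : R) f a -> is_derive x v g b ->
  is_derive x v (fun y => f (g y)) (a * b).
Proof.
move=> df dg; apply: is_derive_of_line.
apply: (@is_derive1_comp _ f (fun s => g (x + s *: v))).
  by rewrite /= scale0r addr0.
by apply: is_derive_line; rewrite scale0r addr0.
Qed.

Lemma is_derive_addl {R : realType} (b : R) :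
  is_derive (0 : R) (1 : R) (fun s : R => b + s) 1.
Proof. by apply: (@is_derive_eq _ _ _ (cst b + id)); rewrite add0r. Qed.

Lemma is_derive_inv_sqr {R : realType} (b e : R) : 0 < b ^+ 2 + e ->
  is_derive (0 : R) (1 : R) (fun s : R => ((b + s) ^+ 2 + e)^-1)
    (- (b ^+ 2 + e) ^- 2 * (2 * b)).
Proof.
move=> be; have d1 := is_derive_addl b.
have -> : - (b ^+ 2 + e) ^- 2 * (2 * b) =
          - ((b + 0) ^+ 2 + e) ^- 2 *: (2 * b) by rewrite addr0.
apply: is_deriveV; first by rewrite addr0 gt_eqF.
apply: (@is_derive_eq _ _ _ ((fun s : R => b + s) ^+ 2 + cst e)).
by rewrite /= !addr0 expr1 [LHS]mulr1.
Qed.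

Section field.
Context {R : realType} {n : nat}.
Implicit Types (x v : 'rV[R]_n.+1).

Definition rho2 (x : 'rV[R]_n.+1) := x 0 ord0 ^+ 2 + x 0 ord_max ^+ 2.

(** The squared cosine of the angle that the vector (x1, y) makes with the
    y axis. *)
Definition weight (x : 'rV[R]_n.+1) := x 0 ord_max ^+ 2 / rho2 x.

Lemma rho2_gt0 x : halfspace R n x -> 0 < rho2 x.
Proof. by move=> Hx; rewrite /rho2 ltr_wpDl ?sqr_ge0// exprn_gt0. Qed.

(** The two nonzero components of y^(1-N) Y, for the field
    Y = a (- e_N + k (x1 y, y^2) / rho^2).  Since N = n + 1, the factor y^(1-N)
    is the n-th power of 1 / y. *)
Definition field1 (a k : R) x := a * k * (x 0 ord0 * x 0 ord_max * (x 0 ord_max)^-1 ^+ n / rho2 x).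
Definition fieldN (a k : R) x := a * ((k * weight x - 1) * (x 0 ord_max)^-1 ^+ n).

Definition dfield1 (a k : R) x := a * k * (x 0 ord_max * (x 0 ord_max)^-1 ^+ n / rho2 x
  * (1 - 2 * x 0 ord0 ^+ 2 / rho2 x)).
Definition dfieldN (a k : R) x := a * (x 0 ord_max)^-1 ^+ n *
  (2 * k * x 0 ord_max / rho2 x * (1 - weight x) - n%:R * (x 0 ord_max)^-1 * (k * weight x - 1)).

Hypothesis n0 : (0 < n)%N.

Lemma ord0_neq_max : ((ord0 : 'I_n.+1) == ord_max) = false.
Proof. by apply/eqP => /(congr1 val) /= /eqP; rewrite eq_sym; apply/negP; rewrite -lt0n. Qed.

Lemma is_derive_field1 a k x : halfspace R n x ->
  is_derive x (delta_mx 0 ord0) (field1 a k) (dfield1 a k x).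
Proof.
move=> Hx; apply: is_derive_of_line.
have -> : (fun s : R => field1 a k (x + s *: delta_mx 0 ord0)) =
  (fun s : R => a * k * (x 0 ord_max * (x 0 ord_max)^-1 ^+ n) *
    ((x 0 ord0 + s) * ((x 0 ord0 + s) ^+ 2 + x 0 ord_max ^+ 2)^-1)).
  apply/funext => s; rewrite /field1 /rho2 !mxE !eqxx (eq_sym ord_max) ord0_neq_max /=.
  by rewrite mulr0 addr0 mulr1; ring.
have r0 := rho2_gt0 Hx.
set b := x 0 ord0; set e := x 0 ord_max ^+ 2.
have d1 := is_derive_addl b.
have d2 := is_derive_inv_sqr r0.
apply: (@is_derive_eq _ _ _ ((a * k * (x 0 ord_max * (x 0 ord_max)^-1 ^+ n)) \*:
  ((fun s : R => b + s) * (fun s : R => ((b + s) ^+ 2 + e)^-1)))).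
rewrite /= addr0 /dfield1 -/b /rho2 -/b -/e.
by rewrite /GRing.scale/=; field; rewrite gt_eqF.
Qed.

Lemma is_derive_fieldN a k x : halfspace R n x ->
  is_derive x (delta_mx 0 ord_max) (fieldN a k) (dfieldN a k x).
Proof.
move=> Hx; apply: is_derive_of_line.
set b := x 0 ord_max; set e := x 0 ord0 ^+ 2.
have -> : (fun s : R => fieldN a k (x + s *: delta_mx 0 ord_max)) =
  (fun s : R => a * ((k * ((b + s) ^+ 2 * ((b + s) ^+ 2 + e)^-1) - 1) * (b + s)^-1 ^+ n)).
  apply/funext => s; rewrite /fieldN /weight /rho2 !mxE !eqxx ord0_neq_max /=.
  by rewrite mulr0 addr0 mulr1 [X in _ / X]addrC.
have b0 : 0 < b := Hx.
have r0 : 0 < b ^+ 2 + e by rewrite addrC; exact: rho2_gt0 Hx.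
have d1 := is_derive_addl b.
have d2 := is_derive_inv_sqr r0.
have d3 : is_derive (0 : R) (1 : R) (fun s : R => (b + s)^-1) (- b ^- 2).
  have -> : - b ^- 2 = - (b + 0) ^- 2 *: 1 by rewrite addr0 [RHS]mulr1.
  by apply: is_deriveV; rewrite ?addr0 ?gt_eqF.
have d4 : is_derive (0 : R) (1 : R) (fun s : R => k * ((b + s) ^+ 2 * ((b + s) ^+ 2 + e)^-1) - 1)
   (2 * k * b / rho2 x * (1 - weight x)).
  apply: (@is_derive_eq _ _ _ (k \*: ((fun s : R => b + s) ^+ 2 *
    (fun s : R => ((b + s) ^+ 2 + e)^-1)) - cst 1)).
  rewrite fctE /= !addr0 /weight /rho2 -/b -/e subr0 expr1 [e + _]addrC /GRing.scale/=; field.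
  by rewrite gt_eqF.
have nE : b^-1 ^+ n = b^-1 ^+ n.-1 * b^-1 by rewrite -exprSr prednK.
have d5 : is_derive (0 : R) (1 : R) (fun s : R => (b + s)^-1 ^+ n)
    (n%:R * b^-1 ^+ n.-1 * - b ^- 2).
  rewrite (_ : (fun s : R => _) = (fun s : R => (b + s)^-1) ^+ n); last first.
    by apply/funext => s; rewrite exprfctE.
  by apply: is_derive_eq; rewrite /= addr0.
apply: (@is_derive_eq _ _ _ (a \*:
  ((fun s : R => k * ((b + s) ^+ 2 * ((b + s) ^+ 2 + e)^-1) - 1) *
   (fun s : R => (b + s)^-1 ^+ n)))).
rewrite /= !addr0 /dfieldN -/b nE /weight /rho2 -/b -/e [e + _]addrC /GRing.scale/=.
by field; rewrite !gt_eqF.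
Qed.

Lemma continuous_coordx x j : {for x, continuous (fun x : 'rV[R]_n.+1 => x 0 j)}.
Proof. exact: coord_continuous. Qed.

Lemma cont_mul (f g : 'rV[R]_n.+1 -> R) x : {for x, continuous f} ->
  {for x, continuous g} -> {for x, continuous (fun x => f x * g x)}.
Proof. by move=> cf cg; exact: (@continuousM _ _ f g x cf cg). Qed.

Lemma cont_add (f g : 'rV[R]_n.+1 -> R) x : {for x, continuous f} ->
  {for x, continuous g} -> {for x, continuous (fun x => f x + g x)}.
Proof. by move=> cf cg; exact: (@continuousD _ _ _ f g x cf cg). Qed.

Lemma cont_opp (f : 'rV[R]_n.+1 -> R) x : {for x, continuous f} ->
  {for x, continuous (fun x => - f x)}.
Proof. by move=> cf; exact: (@continuousN _ _ _ f x cf). Qed.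

Lemma cont_inv (f : 'rV[R]_n.+1 -> R) x : f x != 0 -> {for x, continuous f} ->
  {for x, continuous (fun x => (f x)^-1)}.
Proof. by move=> f0 cf; exact: continuousV. Qed.

Lemma cont_exp (f : 'rV[R]_n.+1 -> R) m x : {for x, continuous f} ->
  {for x, continuous (fun x => f x ^+ m)}.
Proof.
move=> cf; elim: m => [|m IH].
  by rewrite (_ : (fun x => _) = cst 1)//; exact: cst_continuous.
rewrite (_ : (fun x => _) = (fun x => f x * f x ^+ m)); last by apply/funext => z; rewrite exprS.
exact: cont_mul.
Qed.

Lemma cont_cst (c : R) x : {for x, continuous (fun _ : 'rV[R]_n.+1 => c)}.
Proof. exact: cst_continuous. Qed.

Lemma cont_rho2 x : {for x, continuous rho2}.
Proof. by apply: cont_add; apply: cont_exp; exact: continuous_coordx. Qed.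

Lemma cont_rho2V x : halfspace R n x -> {for x, continuous (fun x => (rho2 x)^-1)}.
Proof. by move=> Hx; apply: cont_inv; [rewrite gt_eqF ?rho2_gt0|exact: cont_rho2]. Qed.

Lemma cont_yV x : halfspace R n x -> {for x, continuous (fun x => (x 0 ord_max)^-1)}.
Proof.
by move=> Hx; apply: cont_inv; [rewrite gt_eqF|exact: continuous_coordx].
Qed.

Lemma cont_weight x : halfspace R n x -> {for x, continuous weight}.
Proof.
move=> Hx; apply: cont_mul; last exact: cont_rho2V.
by apply: cont_exp; exact: continuous_coordx.
Qed.

Lemma cont_yVn x m : halfspace R n x ->
  {for x, continuous (fun x => (x 0 ord_max)^-1 ^+ m)}.
Proof. by move=> Hx; apply: cont_exp; exact: cont_yV. Qed.

Lemma cont_field1 a k x : halfspace R n x -> {for x, continuous (field1 a k)}.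
Proof.
move=> Hx; apply: cont_mul; first exact: cont_cst.
apply: cont_mul; last exact: cont_rho2V.
apply: cont_mul; last exact: cont_yVn.
by apply: cont_mul; exact: continuous_coordx.
Qed.

Lemma cont_fieldN a k x : halfspace R n x -> {for x, continuous (fieldN a k)}.
Proof.
move=> Hx; apply: cont_mul; first exact: cont_cst.
apply: cont_mul; last exact: cont_yVn.
apply: cont_add; last exact: cont_cst.
by apply: cont_mul; [exact: cont_cst|exact: cont_weight].
Qed.

Lemma cont_dfield1 a k x : halfspace R n x -> {for x, continuous (dfield1 a k)}.
Proof.
move=> Hx; apply: cont_mul; first exact: cont_cst.
apply: cont_mul.
  apply: cont_mul; last exact: cont_rho2V.
  by apply: cont_mul; [exact: continuous_coordx|exact: cont_yVn].
apply: cont_add; first exact: cont_cst.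
apply: cont_opp; apply: cont_mul; last exact: cont_rho2V.
apply: cont_mul; first exact: cont_cst.
by apply: cont_exp; exact: continuous_coordx.
Qed.

Lemma cont_dfieldN a k x : halfspace R n x -> {for x, continuous (dfieldN a k)}.
Proof.
move=> Hx; have cV := cont_weight Hx.
apply: cont_mul; first by apply: cont_mul; [exact: cont_cst|exact: cont_yVn].
apply: cont_add.
  apply: cont_mul.
    apply: cont_mul; last exact: cont_rho2V.
    by apply: cont_mul; [exact: cont_cst|exact: continuous_coordx].
  by apply: cont_add; [exact: cont_cst|exact: cont_opp].
apply: cont_opp; apply: cont_mul.
  by apply: cont_mul; [exact: cont_cst|exact: cont_yV].
apply: cont_add; last exact: cont_cst.
by apply: cont_mul; [exact: cont_cst|].
Qed.

End field.

(** * The inequality between integrands *)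

Section pointwise.
Context {R : realType} {n : nat}.
Implicit Types (x v : 'rV[R]_n.+1).

(** With the absolute value this holds for every [x], so one formula gives the
    speed of a path also outside [0, 1], where the path may leave the half-space. *)
Lemma hnormE_abs x v :
  hnorm x v = Num.sqrt (\sum_i v 0 i ^+ 2) / `|x 0 ord_max|.
Proof.
rewrite /hnorm /hmetric mul_mx_scalar -scalemxAl mxE mxE.
rewrite (eq_bigr (fun i => v 0 i ^+ 2)) => [|i _]; last by rewrite !mxE.
rewrite mulrC sqrtrM ?sumr_ge0// => [|i _]; last exact: sqr_ge0.
by rewrite -exprVn sqrtr_sqr normfV.
Qed.

Lemma hnormE x v : halfspace R n x ->
  hnorm x v = Num.sqrt (\sum_i v 0 i ^+ 2) / x 0 ord_max.
Proof. by move=> Hx; rewrite hnormE_abs gtr0_norm. Qed.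

Lemma hnorm_hgradE (u : 'rV[R]_n.+1 -> R) x : halfspace R n x ->
  hnorm x (hgrad u x) =
  x 0 ord_max * Num.sqrt (\sum_i ('D_(delta_mx 0 i) u x) ^+ 2).
Proof.
move=> Hx; have y0 : 0 < x 0 ord_max := Hx.
rewrite hnormE// /hgrad /hmetric invmx_scalar invrK mul_mx_scalar.
rewrite (eq_bigr (fun i => (x 0 ord_max ^+ 2) ^+ 2 * ('D_(delta_mx 0 i) u x) ^+ 2)); last first.
  by move=> i _; rewrite !mxE exprMn.
rewrite -mulr_sumr sqrtrM ?sqr_ge0// sqrtr_sqr ger0_norm ?sqr_ge0//.
by rewrite mulrAC expr2 mulfK ?gt_eqF.
Qed.

Lemma cauchy_schwarz2 (A B C D : R) :
  `|A * C + B * D| <= Num.sqrt (A ^+ 2 + B ^+ 2) * Num.sqrt (C ^+ 2 + D ^+ 2).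
Proof.
rewrite -sqrtrM ?addr_ge0 ?sqr_ge0// -sqrtr_sqr; apply: ler_wsqrtr.
by have := sqr_ge0 (A * D - B * C); nra.
Qed.

Lemma dnormpow_le (p z : R) : 0 < p -> `|dnormpow p z| <= p * `|z| `^ (p - 1).
Proof.
move=> p0; rewrite /dnormpow !normrM gtr0_norm// ler_wpM2l ?(ltW p0)// normr_sg.
rewrite [X in _ * X]ger0_norm ?powR_ge0// ler_piMl ?powR_ge0//.
by case: (z != 0).
Qed.

(** The last two lines are the divergence of y^(1-N) |u|^p Y at [x], with [D1] and
    [DN] the derivatives of [u] along the axes of the two components of Y, so
    that this sum will integrate to 0.  By the inequality of Cauchy and Schwarz
    and Young's inequality, the part that contains the derivatives of [u] is
    controlled by g^p and (p - 1) |Y|^q |u|^p. *)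
Lemma pointwise_bound (p C k : R) : (0 < n)%N -> 1 < p ->
  0 <= k -> k <= 1 ->
  (forall t, 0 <= t <= 1 ->
    C * p / n%:R * t <= k * t - n%:R * k * t
      + n%:R * ((p - 1) / p) * (1 - (1 - (2 * k - k ^+ 2) * t) `^ (p / (p - 1) / 2))) ->
  forall x (g u D1 DN : R), halfspace R n x ->
  x 0 ord_max * Num.sqrt (D1 ^+ 2 + DN ^+ 2) <= g ->
  forall b a, b = n%:R / p -> a = b `^ (p - 1) ->
  (b `^ p * `|u| `^ p + b `^ (p - 2) * C * (weight x * `|u| `^ p)) * (x 0 ord_max)^-1 ^+ n.+1
   <= g `^ p * (x 0 ord_max)^-1 ^+ n.+1
      + (dfield1 a k x * `|u| `^ p + field1 a k x * (dnormpow p u * D1)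
      + (dfieldN a k x * `|u| `^ p + fieldN a k x * (dnormpow p u * DN))).
Proof.
move=> n0 p1 k0 k1 prof x g u D1 DN Hx gD b a bE aE.
set y := x 0 ord_max in gD *; have y0 : 0 < y := Hx.
set h := y^-1 ^+ n; set V := weight x; set nu := n%:R in prof bE *.
have p0 : 0 < p by rewrite (lt_trans _ p1).
have p10 : 0 < p - 1 by rewrite subr_gt0.
have nu0 : 0 < nu by rewrite ltr0n.
have b0 : 0 < b by rewrite bE divr_gt0.
have a0 : 0 < a by rewrite aE powR_gt0.
have r0 := rho2_gt0 Hx.
have V01 : 0 <= V <= 1.
  rewrite /V /weight; apply/andP; split; first by rewrite divr_ge0 ?sqr_ge0// ltW.
  by rewrite ler_pdivrMr// mul1r /rho2 lerDr sqr_ge0.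
have h0 : 0 < h by rewrite exprn_gt0// invr_gt0.
have -> : y^-1 ^+ n.+1 = h / y by rewrite exprSr.
pose m := (2 * k - k ^+ 2) * V.
pose A := k * (x 0 ord0 * y / rho2 x); pose B := k * V - 1.
have AB : A ^+ 2 + B ^+ 2 = 1 - m.
  by rewrite /A /B /m /V /weight /rho2 -/y; field; rewrite gt_eqF.
have m1 : 0 <= 1 - m by rewrite -AB addr_ge0 ?sqr_ge0.
pose q := p / (p - 1); have q0 : 0 < q by rewrite divr_gt0.
pose P := (1 - m) `^ (q / 2).
have ab : b `^ p = a * b by rewrite aE mulrC mulr_powRB1// ltW.
have ab2 : a = b `^ (p - 2) * b.
  by rewrite mulrC aE -(@mulr_powRB1 _ b (p - 1)) ?ltW// ; congr (_ * _ `^ _); ring.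
have TP : (a * Num.sqrt (1 - m)) `^ q = a * b * P.
  rewrite powRM ?sqrtr_ge0 ?ltW// -ab aE -powRrM /q [X in b `^ X]mulrC divfK ?gt_eqF//.
  by rewrite -powR12_sqrt// -powRrM mulrC /P mulrC [_^-1 * _]mulrC.
have U0 := powR_ge0 `|u| p.
set U := `|u| `^ p in U0 *.
have pq : p^-1 + q^-1 = 1 by rewrite /q invf_div mulrBl divff ?gt_eqF// div1r subrKC.
have g0 : 0 <= g by apply: le_trans gD; rewrite mulr_ge0 ?sqrtr_ge0// ltW.
have aT0 : 0 <= a * Num.sqrt (1 - m) by rewrite mulr_ge0 ?sqrtr_ge0// ltW.
have := @young_powR _ p q g `|u| (a * Num.sqrt (1 - m)) p1 pq g0 (normr_ge0 _) aT0.
rewrite TP -/U => yng.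
move: (dnormpow p u) (dnormpow_le u p0) => dn dnle.
(* the Cauchy-Schwarz and Young inequalities for the term with derivatives of u *)
have cross : - (a * y * dn * (A * D1 + B * DN))
    <= g `^ p + (p - 1) * (a * b * P) * U.
  apply: le_trans yng; rewrite (le_trans (ler_norm _))// normrN !normrM.
  rewrite (gtr0_norm a0) (gtr0_norm y0).
  have e2 := cauchy_schwarz2 A B D1 DN.
  rewrite AB in e2.
  rewrite (_ : p * `|u| `^ (p - 1) * (a * Num.sqrt (1 - m)) * g = a * (p * `|u| `^ (p - 1) * (Num.sqrt (1 - m) * g))); last by ring.
  set S := A * D1 + B * DN in e2 *.
  rewrite (_ : a * y * `|dn| * `|S| = a * (`|dn| * (y * `|S|))); last by ring.
  rewrite ler_wpM2l ?(ltW a0)//; apply: ler_pM => //.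
    by rewrite mulr_ge0// ltW.
  apply: (@le_trans _ _ (y * (Num.sqrt (1 - m) * Num.sqrt (D1 ^+ 2 + DN ^+ 2)))).
    by rewrite ler_wpM2l// ltW.
  by rewrite mulrCA ler_wpM2l ?sqrtr_ge0.
have main : b `^ p * U + b `^ (p - 2) * C * (V * U) <=
    g `^ p + a * (nu + k * V - nu * k * V) * U
     + a * y * dn * (A * D1 + B * DN).
  have := prof V V01; rewrite -/m -/q -/P => /(ler_wpM2l (ltW a0))/(ler_wpM2r U0) pr.
  have nuE : nu = b * p by rewrite bE divfK ?gt_eqF.
  have e1 : a * (C * p / nu * V) * U = b `^ (p - 2) * C * (V * U).
    by rewrite ab2 nuE; field; rewrite !gt_eqF.
  rewrite ab; rewrite e1 in pr.
  have e2 : a * (k * V - nu * k * V + nu * ((p - 1) / p) * (1 - P)) * U =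
    a * (nu + k * V - nu * k * V) * U - a * b * U - (p - 1) * (a * b * P) * U.
    by rewrite nuE; field; rewrite gt_eqF.
  rewrite e2 in pr; lra.
have hy : 0 <= h / y by rewrite divr_ge0 ?ltW.
apply: le_trans (ler_wpM2r hy main) _.
rewrite le_eqVlt; apply/orP; left; apply/eqP.
rewrite /dfield1 /dfieldN /field1 /fieldN /A /B /V /weight /rho2 -/y -/h -/nu.
have r0' : x 0 ord0 ^+ 2 + y ^+ 2 != 0 by rewrite gt_eqF.
by field; rewrite r0' gt_eqF.
Qed.
End pointwise.

(** * The weighted Poincare inequality *)

Section hardy.
Context {R : realType} {n : nat}.
Implicit Types (x v : 'rV[R]_n.+1).

Local Notation D := [set t : n.+1.-tuple (measurableTypeR R) | halfspace R n (row_of_tuple t)].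

Lemma det_hmetricE x : halfspace R n x ->
  Num.sqrt (\det (hmetric x)) = (x 0 ord_max)^-1 ^+ n.+1.
Proof.
move=> Hx; have y0 : 0 < x 0 ord_max := Hx.
rewrite /hmetric det_scalar -exprVn exprAC sqrtr_sqr ger0_norm//.
by rewrite exprn_ge0// invr_ge0 ltW.
Qed.

Lemma hintegralE (f : 'rV[R]_n.+1 -> R) :
  hintegral f = (\int[lebesgueN R n.+1]_(t in D)
    (f (row_of_tuple t) * ((row_of_tuple t) 0 ord_max)^-1 ^+ n.+1)%:E)%E.
Proof.
rewrite /hintegral; apply: eq_integral => t; rewrite inE /= => Ht.
by rewrite det_hmetricE.
Qed.

Lemma continuous_at_comp (T U V : topologicalType) (g : U -> V) (f : T -> U) (x : T) :
  {for x, continuous f} -> {for f x, continuous g} ->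
  {for x, continuous (fun y => g (f y))}.
Proof. by move=> cf cg; exact: continuous_comp. Qed.

Lemma continuous_at_sum (T : topologicalType) m (F : 'I_m -> T -> R) (x : T) :
  (forall i, {for x, continuous (F i)}) -> {for x, continuous (fun y => \sum_i F i y)}.
Proof.
move=> cF; rewrite /prop_for /continuous_at.
by apply: cvg_big => // [|i _]; [exact: add_continuous|exact: cF].
Qed.

Section oneu.
Variables (u : 'rV[R]_n.+1 -> R) (K : set 'rV[R]_n.+1).
Hypotheses (su : hsmooth u) (cK : compact K) (KH : K `<=` halfspace R n)
  (u0 : vanishes_off K u).

Lemma smooth_derive x i : halfspace R n x ->
  is_derive x (delta_mx 0 i) u ('D_(delta_mx 0 i) u x).
Proof. by move=> Hx; split => //; apply: diff_derivable; exact: (su [::] Hx). Qed.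

Lemma smooth_cont x : halfspace R n x -> {for x, continuous u}.
Proof. by move=> Hx; apply: differentiable_continuous; exact: (su [::] Hx). Qed.

Lemma smooth_cont1 x i : halfspace R n x ->
  {for x, continuous (fun x => 'D_(delta_mx 0 i) u x)}.
Proof. by move=> Hx; apply: differentiable_continuous; exact: (su [:: i] Hx). Qed.

Lemma derive_off i : vanishes_off K (fun x => 'D_(delta_mx 0 i) u x).
Proof. by apply: (derive_vanishes_off cK KH u0) => x Hx; exact: smooth_derive. Qed.

Lemma cont_gradnorm x : halfspace R n x ->
  {for x, continuous (fun x => x 0 ord_max * Num.sqrt (\sum_i ('D_(delta_mx 0 i) u x) ^+ 2))}.
Proof.
move=> Hx; apply: cont_mul; first exact: continuous_coordx.
apply: (@continuous_at_comp _ _ _ Num.sqrt); last exact: sqrt_continuous.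
by apply: continuous_at_sum => i; apply: cont_exp; exact: smooth_cont1.
Qed.

Lemma gradnorm_off : vanishes_off K (fun x => hnorm x (hgrad u x)).
Proof.
move=> x Hx Kx; rewrite hnorm_hgradE// big1 ?sqrtr0 ?mulr0// => i _.
by rewrite derive_off// expr0n.
Qed.

Variables (p : R).
Hypothesis p1 : 1 < p.

Lemma off_powR (f : 'rV[R]_n.+1 -> R) : vanishes_off K f ->
  vanishes_off K (fun x => `|f x| `^ p).
Proof.
by move=> f0 x Hx Kx; rewrite f0// normr0 powR0// gt_eqF// (lt_trans _ p1).
Qed.

Lemma cont_powR (f : 'rV[R]_n.+1 -> R) x : {for x, continuous f} ->
  {for x, continuous (fun x => `|f x| `^ p)}.
Proof.
move=> cf; apply: (@continuous_at_comp _ _ _ (fun z : R => `|z| `^ p)) => //.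
by apply: continuous_normpow; rewrite (lt_trans _ p1).
Qed.

Lemma integrable_density (f : 'rV[R]_n.+1 -> R) : vanishes_off K f ->
  (forall x, halfspace R n x -> {for x, continuous f}) ->
  (lebesgueN R n.+1).-integrable D
    (fun t => (f (row_of_tuple t) * ((row_of_tuple t) 0 ord_max)^-1 ^+ n.+1)%:E).
Proof.
move=> f0 cf; apply: (@tame_integrable _ _ K
  (fun x => f x * (x 0 ord_max)^-1 ^+ n.+1)) => //.
  by move=> x Hx Kx; rewrite f0// mul0r.
move=> x Hx; apply: cont_mul; first exact: cf.
by apply: cont_exp; exact: cont_yV.
Qed.

(** The i-th term of the divergence of X |u|^p, when [dX] is the i-th partial
    derivative of the i-th component [X]. *)
Definition flux_div (X dX : 'rV[R]_n.+1 -> R) i x :=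
  dX x * `|u x| `^ p + X x * (dnormpow p (u x) * 'D_(delta_mx 0 i) u x).

Lemma flux_derive (X dX : 'rV[R]_n.+1 -> R) i x : halfspace R n x ->
  is_derive x (delta_mx 0 i) X (dX x) ->
  is_derive x (delta_mx 0 i) (fun x => X x * `|u x| `^ p)
   (flux_div X dX i x).
Proof.
move=> Hx dXx.
have dw : is_derive x (delta_mx 0 i) (fun x => `|u x| `^ p)
    (dnormpow p (u x) * 'D_(delta_mx 0 i) u x).
  apply: (@is_derive_compR _ _ (fun z => `|z| `^ p)); first exact: is_derive_normpow.
  exact: smooth_derive.
by apply: is_derive_eq; rewrite /flux_div /GRing.scale/=; ring.
Qed.

Lemma flux_integral (X dX : 'rV[R]_n.+1 -> R) i :
  (forall x, halfspace R n x -> is_derive x (delta_mx 0 i) X (dX x)) ->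
  (forall x, halfspace R n x -> {for x, continuous X}) ->
  (forall x, halfspace R n x -> {for x, continuous dX}) ->
  let G := flux_div X dX i in
  (lebesgueN R n.+1).-integrable D (fun t => (G (row_of_tuple t))%:E) /\
  (\int[lebesgueN R n.+1]_(t in D) (G (row_of_tuple t))%:E = 0)%E.
Proof.
move=> dX_ cX cdX G.
have F0 : vanishes_off K (fun x => X x * `|u x| `^ p).
  by move=> x Hx Kx; rewrite (off_powR u0)// mulr0.
have dF x : halfspace R n x ->
    is_derive x (delta_mx 0 i) (fun x => X x * `|u x| `^ p) (G x).
  by move=> Hx; apply: flux_derive => //; exact: dX_.
have cG x : halfspace R n x -> {for x, continuous G}.
  move=> Hx; apply: cont_add; apply: cont_mul; [exact: cdX| |exact: cX|].
    by apply: cont_powR; exact: smooth_cont.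
  apply: cont_mul; last exact: smooth_cont1.
  apply: (@continuous_at_comp _ _ _ (dnormpow p)); first exact: smooth_cont.
  exact: continuous_dnormpow.
split; last exact: (integral_partial0 cK KH F0 dF cG).
by apply: (tame_integrable cK KH _ cG); exact: derive_vanishes_off F0 dF.
Qed.

Lemma weighted_poincare (C : R) : (0 < n)%N -> C <= Cmax p ->
  ((((n%:R / p) `^ (p - 2) * C)%:E * hintegral (fun x => (weight x * `|u x| `^ p)%R))
   <= hintegral (fun x => (hnorm x (hgrad u x) `^ p)%R)
      - ((n%:R / p) `^ p)%:E * hintegral (fun x => (`|u x| `^ p)%R))%E.
Proof.
move=> n0 CC.
have [k [k0 k1 prof]] := @angular_profile _ p n%:R C p1 (eqbRL (ler1n _ _) n0) CC.
pose b : R := n%:R / p; pose a := b `^ (p - 1); rewrite -/b.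
have [iG1 G10] := @flux_integral (field1 a k) (dfield1 a k) ord0
  (@is_derive_field1 _ _ n0 a k) (@cont_field1 _ _ a k) (@cont_dfield1 _ _ a k).
have [iGN GN0] := @flux_integral (fieldN a k) (dfieldN a k) ord_max
  (@is_derive_fieldN _ _ n0 a k) (@cont_fieldN _ _ a k) (@cont_dfieldN _ _ a k).
set G1 := flux_div (field1 a k) _ _ in iG1 G10.
set GN := flux_div (fieldN a k) _ _ in iGN GN0.
pose g x := hnorm x (hgrad u x).
have cu x : halfspace R n x -> {for x, continuous (fun x => `|u x| `^ p)}.
  by move=> Hx; apply: cont_powR; exact: smooth_cont.
have iu := integrable_density (off_powR u0) cu.
have V0 : vanishes_off K (fun x => weight x * `|u x| `^ p).
  by move=> x Hx Kx; rewrite (off_powR u0)// mulr0.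
have iV := integrable_density V0 (fun x Hx => cont_mul (cont_weight Hx) (cu x Hx)).
have ge0 x : 0 <= g x by exact: sqrtr_ge0.
have g0 : vanishes_off K (fun x => g x `^ p).
  by move=> x Hx Kx; rewrite /g gradnorm_off// powR0// gt_eqF// (lt_trans _ p1).
have cg x : halfspace R n x -> {for x, continuous (fun x => g x `^ p)}.
  move=> Hx; apply: near_eq_continuous (cont_powR (cont_gradnorm Hx)).
  have : \forall y \near x, halfspace R n y.
    by apply: open_nbhs_nbhs; split => //; exact: open_halfspace.
  by apply: filterS => y Hy; rewrite -hnorm_hgradE// -/(g y) ger0_norm ?ge0.
have ig := integrable_density g0 cg.
have mD := @measurable_halfspace R n.
rewrite !hintegralE.
pose w (t : n.+1.-tuple (measurableTypeR R)) : R := ((row_of_tuple t) 0 ord_max)^-1 ^+ n.+1.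
pose LHS (t : n.+1.-tuple (measurableTypeR R)) := (((b `^ p)%:E * (`|u (row_of_tuple t)| `^ p * w t)%:E)
  + ((b `^ (p - 2) * C)%:E * (weight (row_of_tuple t) * `|u (row_of_tuple t)| `^ p * w t)%:E))%E.
pose RHS (t : n.+1.-tuple (measurableTypeR R)) := ((g (row_of_tuple t) `^ p * w t)%:E +
  ((G1 (row_of_tuple t))%:E + (GN (row_of_tuple t))%:E))%E.
have iL1 := integrableZl mD (b `^ p) iu.
have iL2 := integrableZl mD (b `^ (p - 2) * C) iV.
have iR2 := integrableD mD iG1 iGN.
have le : (\int[lebesgueN R n.+1]_(t in D) LHS t <= \int[lebesgueN R n.+1]_(t in D) RHS t)%E.
  apply: le_integral => //; first exact: integrableD.
    exact: integrableD.
  move=> t; rewrite inE /= => Ht; pose x := row_of_tuple t.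
  have gx : x 0 ord_max * Num.sqrt (('D_(delta_mx 0 ord0) u x) ^+ 2
       + ('D_(delta_mx 0 ord_max) u x) ^+ 2) <= g x.
    rewrite /g hnorm_hgradE//; apply: ler_wpM2l; first exact: ltW.
    apply: ler_wsqrtr.
    rewrite (bigD1 ord0)//= (bigD1 ord_max)/=; last by rewrite eq_sym ord0_neq_max.
    by rewrite addrA lerDl sumr_ge0// => i _; exact: sqr_ge0.
  have := pointwise_bound n0 p1 k0 k1 prof (u x) Ht gx erefl erefl.
  rewrite -/b -/a => H.
  have -> : LHS t = ((b `^ p * `|u x| `^ p + b `^ (p - 2) * C * (weight x * `|u x| `^ p))
      * (x 0 ord_max)^-1 ^+ n.+1)%:E.
    by rewrite /LHS /w -/x -!EFinM -EFinD mulrDl !mulrA.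
  by rewrite lee_fin; exact: H.
move: le; rewrite (integralD mD iL1 iL2) (integralD mD ig iR2) (integralD mD iG1 iGN).
rewrite G10 GN0 !adde0 (integralZl mD iu) (integralZl mD iV).
have fu := integrable_fin_num mD iu.
by move=> H; rewrite leeBrDr ?fin_numM//; move: H; rewrite [X in (X <= _)%E -> _]addeC.
Qed.
End oneu.
End hardy.

(** * Lengths of paths and lower bounds for the hyperbolic distance *)

Section paths.
Context {R : realType} {n : nat}.
Implicit Types (x y v : 'rV[R]_n.+1) (c : R -> 'rV[R]_n.+1) (t : R).

Local Notation I01 := (`[0, 1]%classic : set R).

Lemma hnorm_ge0 x v : 0 <= hnorm x v. Proof. exact: sqrtr_ge0. Qed.

Lemma path_coord c t i : derivable c t 1 ->
  is_derive t (1 : R) (fun s => c s 0 i) ('D_1 c t 0 i).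
Proof.
move=> dc; split; first by have /derivable_mxP := dc; exact.
by rewrite derive_mx// mxE.
Qed.

Lemma continuous_01_integrable (f : R -> R) :
  (forall t, 0 <= t <= 1 -> {for t, continuous f}) ->
  lebesgue_measure.-integrable I01 (EFin \o f).
Proof.
move=> cf; apply: continuous_compact_integrable; first exact: segment_compact.
by apply: continuous_in_subspaceT => t; rewrite inE/= in_itv/=; exact: cf.
Qed.

Lemma Rintegral_derive (f df : R -> R) :
  (forall t, 0 <= t <= 1 -> is_derive t (1 : R) f (df t)) ->
  (forall t, 0 <= t <= 1 -> {for t, continuous df}) ->
  \int[lebesgue_measure]_(t in I01) df t = f 1 - f 0.
Proof.
move=> dff cdf.
have cf t : 0 <= t <= 1 -> {for t, continuous f}.
  move=> t01; apply: differentiable_continuous; apply/derivable1_diffP.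
  by have [] := dff t t01.
rewrite /Rintegral (@continuous_FTC2 _ df f)//.
- by apply: continuous_in_subspaceT => t; rewrite inE/= in_itv/=; exact: cdf.
- split.
  + by move=> t; rewrite in_itv/= => /andP[t0 t1]; have [|] := dff t; rewrite ?ltW.
  + by apply: cvg_at_right_filter; apply: cf; rewrite lexx ler01.
  + by apply: cvg_at_left_filter; apply: cf; rewrite lexx ler01.
- move=> t; rewrite in_itv/= => /andP[t0 t1]; rewrite derive1E.
  by have [|_ ->] := dff t; rewrite ?ltW.
Qed.

Lemma continuous_at_sqr (T : topologicalType) (f : T -> R) (z : T) :
  {for z, continuous f} -> {for z, continuous (fun w => f w ^+ 2)}.
Proof. by move=> cf; exact: (@continuousM _ _ f f z cf cf). Qed.

Section one_path.
Variables (x y : 'rV[R]_n.+1) (c : R -> 'rV[R]_n.+1).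
Hypothesis hc : hpath x y c.

Lemma path_coord_cont t i : {for t, continuous (fun s => c s 0 i)}.
Proof.
case: hc => dc _ _ _ _; apply: differentiable_continuous; apply/derivable1_diffP.
by have [] := path_coord i (dc t).
Qed.

Lemma path_dcoord_cont t i : {for t, continuous (fun s => 'D_1 c s 0 i)}.
Proof.
case: hc => _ cdc _ _ _.
exact: (@continuous_at_comp _ _ _ (fun M : 'rV[R]_n.+1 => M 0 i) (fun s => 'D_1 c s) t
  (cdc t) (@coord_continuous _ _ _ _ _ _)).
Qed.

Lemma speed_cont t : 0 <= t <= 1 -> {for t, continuous (fun s => hnorm (c s) ('D_1 c s))}.
Proof.
move=> t01; case: (hc) => _ _ /(_ t t01) Ht _ _.
rewrite (_ : (fun s => _) = (fun s => Num.sqrt (\sum_i ('D_1 c s 0 i) ^+ 2) * `|c s 0 ord_max|^-1));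
  last by apply/funext => s; rewrite hnormE_abs.
apply: (@continuousM _ _ (fun s => Num.sqrt (\sum_i ('D_1 c s 0 i) ^+ 2))).
  apply: (@continuous_at_comp _ _ _ Num.sqrt); last exact: sqrt_continuous.
  apply: continuous_at_sum => i.
  by apply: continuous_at_sqr; exact: path_dcoord_cont.
apply: (@continuousV _ _ (fun s => `|c s 0 ord_max|)).
  by rewrite normr_eq0 gt_eqF.
apply: (@continuous_at_comp _ _ _ (fun z : R => `|z|)); first exact: path_coord_cont.
exact: norm_continuous.
Qed.

Lemma speed_integrable :
  lebesgue_measure.-integrable I01 (EFin \o (fun s => hnorm (c s) ('D_1 c s))).
Proof. by apply: continuous_01_integrable; exact: speed_cont. Qed.

(** The change of a function along a path is at most its Lipschitz constant times
    the length. *)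
Lemma length_ge (f df : R -> R) (M : R) :
  (forall t, 0 <= t <= 1 -> is_derive t (1 : R) f (df t)) ->
  (forall t, 0 <= t <= 1 -> {for t, continuous df}) ->
  (forall t, 0 <= t <= 1 -> `|df t| <= M * hnorm (c t) ('D_1 c t)) ->
  `|f 1 - f 0| <= M * hyp_length c.
Proof.
move=> dff cdf dfM; rewrite -(Rintegral_derive dff cdf).
have idf := continuous_01_integrable cdf.
apply: le_trans (le_normr_Rintegral _ idf) _ => //.
rewrite /hyp_length -RintegralZl//; last exact: speed_integrable.
apply: le_Rintegral => //.
- apply: continuous_01_integrable => t t01.
  apply: (@continuous_at_comp _ _ _ (fun z : R => `|z|)); first exact: cdf.
  exact: norm_continuous.
- apply: continuous_01_integrable => t t01.
  apply: (@continuousM _ _ (cst M)); first exact: cst_continuous.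
  exact: speed_cont.
Qed.

Lemma length_le (f df : R -> R) :
  (forall t, 0 <= t <= 1 -> is_derive t (1 : R) f (df t)) ->
  (forall t, 0 <= t <= 1 -> {for t, continuous df}) ->
  (forall t, 0 <= t <= 1 -> hnorm (c t) ('D_1 c t) <= df t) ->
  hyp_length c <= f 1 - f 0.
Proof.
move=> dff cdf dfM; rewrite -(Rintegral_derive dff cdf).
apply: le_Rintegral => //.
- exact: speed_integrable.
- exact: continuous_01_integrable.
Qed.

Lemma hdist_le_length : hdist x y <= hyp_length c.
Proof.
apply: ge_inf; last by exists c.
exists 0 => _ [c' _ <-]; by apply: Rintegral_ge0 => t _; exact: hnorm_ge0.
Qed.

End one_path.

Lemma hpath_coords (g dg : 'I_n.+1 -> R -> R) :
  (forall i t, is_derive t (1 : R) (g i) (dg i t)) ->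
  (forall i, continuous (dg i)) ->
  (forall t, 0 <= t <= 1 -> 0 < g ord_max t) ->
  hpath (\row_i g i 0) (\row_i g i 1) (fun t => \row_i g i t) /\
  forall t, 'D_1 (fun t => \row_i g i t) t = \row_i dg i t.
Proof.
move=> dgg cdg g0.
have E i : (fun t => (\row_i g i t) (0 : 'I_1) i) = g i.
  by apply/funext => t; rewrite mxE.
have d t : derivable (fun t => \row_i g i t) t 1.
  by apply/derivable_mxP => k i; rewrite ord1 E; have [] := dgg i t.
have D t : 'D_1 (fun t => \row_i g i t) t = \row_i dg i t.
  by apply/rowP => i; rewrite derive_mx// !mxE E; have [_ ->] := dgg i t.
split => //; split => //.
- have -> : (fun t : R => 'D_1 (fun t => \row_i g i t) t) = (fun t => \row_i dg i t).
    by apply/funext => t; exact: D.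
  move=> t; apply: row_cvg => i; rewrite mxE.
  rewrite (_ : (fun s => _) = dg i); first exact: cdg.
  by apply/funext => s; rewrite mxE.
- by move=> t t01; rewrite /halfspace/= mxE; exact: g0.
Qed.

(** The segment between two points of a half-space. *)
Lemma hpath_nonempty x y : halfspace R n x -> halfspace R n y ->
  exists c, hpath x y c.
Proof.
rewrite /halfspace /= => Hx Hy.
have [|||hc _] := @hpath_coords (fun i t => x 0 i + t * (y 0 i - x 0 i))
  (fun i _ => y 0 i - x 0 i).
- move=> i t; rewrite (_ : (fun t => _) = cst (x 0 i) + (y 0 i - x 0 i) \*: (@id R)).
    by apply: is_derive_eq; rewrite add0r [LHS]mulr1.
  by apply/funext => s /=; rewrite mulrC.
- by move=> i; exact: cst_continuous.
- move=> t /andP[t0 t1].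
  by rewrite (_ : _ + _ = (1 - t) * x 0 ord_max + t * y 0 ord_max); [nra|ring].
have hx : \row_i (x 0 i + 0 * (y 0 i - x 0 i)) = x.
  by apply/rowP => i; rewrite mxE mul0r addr0.
have hy : \row_i (x 0 i + 1 * (y 0 i - x 0 i)) = y.
  by apply/rowP => i; rewrite mxE mul1r subrKC.
by rewrite hx hy in hc; eexists; exact: hc.
Qed.

Lemma hdist_ge x y (L : R) : halfspace R n x -> halfspace R n y ->
  (forall c, hpath x y c -> L <= hyp_length c) -> L <= hdist x y.
Proof.
move=> Hx Hy H; apply: lb_le_inf => [|_ [c hc <-]]; last exact: H.
by have [c hc] := hpath_nonempty Hx Hy; exists (hyp_length c); exists c.
Qed.

(** The logarithm of the height changes at most at the speed of the path. *)
Lemma hdist_ge_ln x y : halfspace R n x -> halfspace R n y ->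
  `|ln (y 0 ord_max) - ln (x 0 ord_max)| <= hdist x y.
Proof.
move=> Hx Hy; apply: hdist_ge => // c hc; case: (hc) => dc _ cH c0 c1.
rewrite -c0 -c1 -[leRHS]mul1r.
apply: (length_ge hc (f := fun t => ln (c t 0 ord_max))
   (df := fun t => (c t 0 ord_max)^-1 * 'D_1 c t 0 ord_max)).
- move=> t t01; apply: (@is_derive1_comp _ (@ln R)).
    by apply: is_derive1_ln; exact: cH.
  exact: path_coord.
- move=> t t01; have ct : 0 < c t 0 ord_max := cH t t01.
  apply: (@continuousM _ _ (fun t => (c t 0 ord_max)^-1)).
    apply: (@continuousV _ _ (fun s => c s 0 ord_max)); first by rewrite gt_eqF.
    exact: path_coord_cont hc _ _.
  exact: path_dcoord_cont hc _ _.
- move=> t t01; have ct : 0 < c t 0 ord_max := cH t t01.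
  rewrite mul1r hnormE// normrM normfV (gtr0_norm ct) mulrC ler_wpM2r ?invr_ge0 ?(ltW ct)//.
  rewrite -sqrtr_sqr; apply: ler_wsqrtr.
  by rewrite (bigD1 ord_max)//= lerDl sumr_ge0// => i _; exact: sqr_ge0.
Qed.

Lemma is_derive_add1_sqr2 (f g : R -> R) t (df dg : R) :
  is_derive t (1 : R) f df -> is_derive t (1 : R) g dg ->
  is_derive t (1 : R) (fun s => 1 + (f s ^+ 2 + g s ^+ 2)) (2 * (f t * df + g t * dg)).
Proof.
move=> hf hg.
have -> : (fun s => 1 + (f s ^+ 2 + g s ^+ 2)) = cst 1 + (f * f + g * g).
  by apply/funext => s; rewrite !fctE.
have -> : 2 * (f t * df + g t * dg) =
    0 + ((f t *: df + f t *: df) + (g t *: dg + g t *: dg)).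
  by rewrite /GRing.scale/=; ring.
exact: is_deriveD (is_derive_cst _ _ _) (is_deriveD (is_deriveM hf hf) (is_deriveM hg hg)).
Qed.

Hypothesis n0 : (0 < n)%N.

(** The function log (1 + rho^2) is 2-Lipschitz: its hyperbolic gradient has norm
    2 y rho / (1 + rho^2), and y <= rho. *)
Lemma hdist_ge_rho2 x y : halfspace R n x -> halfspace R n y ->
  `|ln (1 + rho2 y) - ln (1 + rho2 x)| <= 2 * hdist x y.
Proof.
move=> Hx Hy; rewrite -ler_pdivrMl//; apply: hdist_ge => // c hc; rewrite ler_pdivrMl//.
case: (hc) => dc _ cH c0 c1; rewrite -c0 -c1.
pose a t := c t 0 ord0; pose b t := c t 0 ord_max.
pose da t := 'D_1 c t 0 ord0; pose db t := 'D_1 c t 0 ord_max.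
have r0 t : 0 < 1 + rho2 (c t) by rewrite ltr_pwDl// addr_ge0 ?sqr_ge0.
have drho t : is_derive t (1 : R) (fun t => 1 + rho2 (c t)) (2 * (a t * da t + b t * db t)).
  exact: is_derive_add1_sqr2 (path_coord ord0 (dc t)) (path_coord ord_max (dc t)).
apply: (length_ge hc (f := fun t => ln (1 + rho2 (c t)))
   (df := fun t => (1 + rho2 (c t))^-1 * (2 * (a t * da t + b t * db t)))).
- move=> t t01; apply: (@is_derive1_comp _ (@ln R) (fun t => 1 + rho2 (c t))).
  exact: is_derive1_ln.
- move=> t t01.
  have ca : {for t, continuous a} by exact: path_coord_cont hc _ _.
  have cb : {for t, continuous b} by exact: path_coord_cont hc _ _.
  have cda : {for t, continuous da} by exact: path_dcoord_cont hc _ _.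
  have cdb : {for t, continuous db} by exact: path_dcoord_cont hc _ _.
  apply: (@continuousM _ _ (fun t => (1 + rho2 (c t))^-1)).
    apply: (@continuousV _ _ (fun s => 1 + rho2 (c s))); first by rewrite gt_eqF.
    apply: differentiable_continuous; apply/derivable1_diffP.
    by have [] := drho t.
  apply: (@continuousM _ _ (cst 2)); first exact: cst_continuous.
  by apply: (@continuousD _ _ _ (fun t => a t * da t)); apply: continuousM.
- move=> t t01; have ct : 0 < b t := cH t t01.
  rewrite hnormE// -/(b t) normrM normfV (gtr0_norm (r0 t)) ler_pdivrMl//.
  rewrite normrM gtr0_norm// mulrCA ler_wpM2l//.
  have cs := cauchy_schwarz2 (a t) (b t) (da t) (db t).
  set S := Num.sqrt (\sum_i _).
  have dS : Num.sqrt (da t ^+ 2 + db t ^+ 2) <= S.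
    apply: ler_wsqrtr; rewrite (bigD1 ord0)//= (bigD1 ord_max)/=; last by rewrite eq_sym ord0_neq_max.
    by rewrite addrA lerDl sumr_ge0// => i _; exact: sqr_ge0.
  set r := Num.sqrt (a t ^+ 2 + b t ^+ 2) in cs.
  have r2 : r ^+ 2 = rho2 (c t) by rewrite sqr_sqrtr ?addr_ge0 ?sqr_ge0.
  have rg : 0 <= r by exact: sqrtr_ge0.
  have br : b t <= r by rewrite -[b t]gtr0_norm// -sqrtr_sqr; apply: ler_wsqrtr; rewrite lerDr sqr_ge0.
  apply: (le_trans cs); apply: (@le_trans _ _ (r * S)); first by rewrite ler_wpM2l.
  rewrite mulrA ler_pdivlMr// -r2.
  have S0 : 0 <= S by exact: sqrtr_ge0.
  rewrite mulrAC; apply: ler_wpM2r => //.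
  have := ler_wpM2l rg br; rewrite -expr2; lra.
Qed.

End paths.

(** * Upper bounds for the hyperbolic distance *)

Section upper.
Context {R : realType} {n : nat}.
Implicit Types (x y z v : 'rV[R]_n.+1) (c : R -> 'rV[R]_n.+1) (t : R).
Hypothesis n0 : (0 < n)%N.

Definition set_ends x (w h : R) : 'rV[R]_n.+1 :=
  \row_i (if i == ord_max then h else if i == ord0 then w else x 0 i).

Lemma set_ends_max x w h : set_ends x w h 0 ord_max = h.
Proof. by rewrite mxE eqxx. Qed.

Lemma set_ends_0 x w h : set_ends x w h 0 ord0 = w.
Proof. by rewrite mxE eqxx ord0_neq_max. Qed.

Lemma set_ends_halfspace x w h : 0 < h -> halfspace R n (set_ends x w h).
Proof. by rewrite /halfspace/= set_ends_max. Qed.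

Lemma is_derive_expM (m t : R) :
  is_derive t (1 : R) (fun t => expR (m * t)) (m * expR (m * t)).
Proof.
rewrite mulrC; apply: (@is_derive1_comp _ (@expR R) (fun t => m * t)).
apply: (@is_derive_eq _ _ _ (m \*: (@id R))); exact: mulr1.
Qed.

Lemma continuous_expM (m : R) : continuous (fun t : R => expR (m * t)).
Proof.
move=> t; apply: differentiable_continuous; apply/derivable1_diffP.
by have [] := is_derive_expM m t.
Qed.

Lemma sqrt_sum2_le (a b : R) : Num.sqrt (a ^+ 2 + b ^+ 2) <= `|a| + `|b|.
Proof.
rewrite -[leRHS]ger0_norm ?addr_ge0// -sqrtr_sqr; apply: ler_wsqrtr.
rewrite -(real_normK (num_real a)) -(real_normK (num_real b)).
have := mulr_ge0 (normr_ge0 a) (normr_ge0 b); nra.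
Qed.

(** The path has height h e^(m t) with m = log (y / h), and its first coordinate
    is affine in the square of the height, so that it moves sideways mostly
    where this is cheap.  Its speed is at most the derivative of an explicit
    function. *)
Lemma hdist_parabola x w h : halfspace R n x -> 0 < h -> h != x 0 ord_max ->
  hdist (set_ends x w h) x <=
    `|ln (x 0 ord_max) - ln h| + 2 * `|x 0 ord0 - w| / (h + x 0 ord_max).
Proof.
move=> Hx h0 hy; set y := x 0 ord_max in hy *; have y0 : 0 < y := Hx.
set D := x 0 ord0 - w; pose m := ln y - ln h; pose L := y / h.
have L0 : 0 < L by rewrite divr_gt0.
have eL : expR m = L by rewrite expRB !lnK.
have m0 : m != 0.
  by rewrite subr_eq0; apply/eqP => /(ln_inj y0 h0)/esym/eqP; apply/negP.
(* the path has first coordinate w + D (e^(2 m t) - 1) / (e^(2 m) - 1) *)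
pose k := (L ^+ 2 - 1)^-1.
have L1 : L ^+ 2 - 1 != 0.
  rewrite subr_sqr_1 mulf_neq0//; last by rewrite gt_eqF// addr_gt0.
  rewrite subr_eq0; apply/eqP => /(congr1 ( *%R^~ h)); rewrite mul1r divfK ?gt_eqF//.
  by move/esym/eqP; apply/negP.
have mk : 0 < m * k.
  rewrite /k; have [mp|mn|/eqP] := ltgtP m 0; last by rewrite (negbTE m0).
    rewrite nmulr_rgt0// invr_lt0 subr_lt0 exprn_ilt1// ?ltW// -eL.
    by rewrite -[ltRHS]expR0 ltr_expR.
  rewrite mulr_gt0// invr_gt0 subr_gt0 exprn_egt1//.
  by rewrite -eL -[ltLHS]expR0 ltr_expR.
pose E t := expR (m * t).
have E0 t : 0 < E t by exact: expR_gt0.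
have dE t : is_derive t (1 : R) E (m * E t) by exact: is_derive_expM.
have cE : continuous E by exact: continuous_expM.
pose g i t := if i == ord_max then h * E t
  else if i == ord0 then w + D * k * (E t * E t - 1) else x 0 i.
pose dg (i : 'I_n.+1) t := if i == ord_max then h * (m * E t)
  else if i == ord0 then D * k * (2 * m * (E t * E t)) else 0.
have [|||hc Dc] := @hpath_coords R n g dg.
- move=> i t; rewrite /g /dg; case: ifP => _.
    by apply: (@is_derive_eq _ _ _ (h \*: E)).
  case: ifP => _; last exact: is_derive_cst.
  apply: (@is_derive_eq _ _ _ (cst w + (D * k) \*: (E * E - cst 1))).
  by rewrite /GRing.scale/=; ring.
- move=> i; rewrite /dg; case: (i == ord_max) => t.
    by apply: cvgMl_tmp; apply: cvgMl_tmp; exact: cE.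
  case: (i == ord0); last exact: cst_continuous.
  apply: cvgMl_tmp; apply: cvgMl_tmp.
  exact: (@continuousM _ _ E E t (cE t) (cE t)).
- by move=> t _; rewrite /g eqxx mulr_gt0.
have e0 : \row_i g i 0 = set_ends x w h.
  apply/rowP => i; rewrite !mxE /g /E mulr0 expR0.
  by case: ifP => _; rewrite ?mulr1 ?subrr ?mulr0 ?addr0.
have e1 : \row_i g i 1 = x.
  apply/rowP => i; rewrite !mxE /g /E mulr1 eL.
  case: eqP => [->|_]; first by rewrite mulrC divfK ?gt_eqF.
  by case: eqP => [->|//]; rewrite -expr2 mulfVK// subrKC.
rewrite e0 e1 in hc.
apply: (le_trans (hdist_le_length hc)).
have := length_le hc (f := fun t => `|m| * t + (2 * `|D| / h * k) * E t)
  (df := fun t => `|m| + (2 * `|D| / h * k) * (m * E t)).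
move=> /(_ _ _ _)/le_trans; apply.
- move=> t _; apply: (@is_derive_eq _ _ _ (`|m| \*: (@id R) + (2 * `|D| / h * k) \*: E)).
  by congr (_ + _); exact: mulr1.
- move=> t _; apply: (@continuousD _ _ _ (cst `|m|)); first exact: cst_continuous.
  by apply: cvgMl_tmp; apply: cvgMl_tmp; exact: cE.
- move=> t _; rewrite hnormE_abs Dc mxE /g eqxx (bigD1 ord0)//= (bigD1 ord_max)/=; last first.
    by rewrite eq_sym ord0_neq_max.
  rewrite big1 ?addr0; last first.
    by move=> i /andP[/negbTE i0 /negbTE iN]; rewrite mxE /dg iN i0 expr0n.
  have dgN : dg ord_max t = h * (m * E t) by rewrite /dg eqxx.
  have dg0 : dg ord0 t = D * k * (2 * m * (E t * E t)) by rewrite /dg ord0_neq_max// eqxx.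
  rewrite !mxE dg0 dgN.
  have hE : 0 < h * E t by rewrite mulr_gt0.
  rewrite (gtr0_norm hE) ler_pdivrMr//; apply: (le_trans (sqrt_sum2_le _ _)).
  rewrite (_ : D * k * (2 * m * (E t * E t)) = D * (m * k * (2 * (E t * E t)))); last by ring.
  rewrite normrM [X in _ * X]gtr0_norm; last by rewrite mulr_gt0// mulr_gt0// mulr_gt0.
  have -> : h * (m * E t) = m * (h * E t) by ring.
  rewrite [X in _ + X]normrM (gtr0_norm hE).
  rewrite le_eqVlt; apply/orP; left; apply/eqP; field.
  by rewrite gt_eqF.
- have E1 : E 1 = L by rewrite /E mulr1.
  have E00 : E 0 = 1 by rewrite /E mulr0 expR0.
  rewrite E1 E00 mulr0 add0r mulr1 -/m -addrA lerD2l.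
  rewrite -mulrBr le_eqVlt; apply/orP; left; apply/eqP.
  have hyp0 : h + y != 0 by rewrite gt_eqF// addr_gt0.
  have e2 : k * (L - 1) = h / (h + y).
    apply: (mulfI L1); rewrite /k mulVKf// /L; field.
    by rewrite hyp0 gt_eqF.
  have -> : 2 * `|D| / h * k * (L - 1) = 2 * `|D| / h * (k * (L - 1)) by ring.
  by rewrite e2; field; rewrite hyp0 gt_eqF.
Qed.

Lemma sqrt_add_le (S p q : R) : 0 <= S ->
  Num.sqrt (S + (p - q) ^+ 2) <= Num.sqrt (S + p ^+ 2) + `|q|.
Proof.
move=> S0; have T0 : 0 <= S + p ^+ 2 by rewrite addr_ge0 ?sqr_ge0.
set T := Num.sqrt (S + p ^+ 2).
have Tg : 0 <= T by exact: sqrtr_ge0.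
have T2 : T ^+ 2 = S + p ^+ 2 by rewrite sqr_sqrtr.
have pT : `|p| <= T by rewrite -sqrtr_sqr; apply: ler_wsqrtr; rewrite lerDr.
rewrite -[leRHS]ger0_norm ?addr_ge0// -sqrtr_sqr; apply: ler_wsqrtr.
have pq : - (p * q) <= T * `|q|.
  by rewrite (le_trans (ler_norm _))// normrN normrM ler_wpM2r.
rewrite sqrrB sqrrD T2 (real_normK (num_real q)); lra.
Qed.

(** [S] is the squared Euclidean speed in the horizontal directions, [A] and [d]
    the height and its derivative, and [e] the value of a factor e^(m (1 - t))
    by which the height is multiplied. *)
Lemma scaled_speed_le (S A d m e : R) : 0 <= S -> 0 < A ->
  0 < e -> e <= expR `|m| -> e^-1 <= expR `|m| ->
  Num.sqrt (S + (e * (d - m * A)) ^+ 2) / (A * e) <=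
  expR `|m| * (Num.sqrt (S + d ^+ 2) / A) + `|m|.
Proof.
move=> S0 A0 e0 e1 e2.
have M1 : 1 <= expR `|m| by rewrite -expR0 ler_expR.
have Ae : 0 < A * e by rewrite mulr_gt0.
rewrite ler_pdivrMr// mulrBr.
apply: (le_trans (sqrt_add_le _ _ S0)).
rewrite mulrDl; apply: lerD; last first.
  by rewrite !normrM (gtr0_norm A0) (gtr0_norm e0) le_eqVlt; apply/orP; left; apply/eqP; ring.
have -> : expR `|m| * (Num.sqrt (S + d ^+ 2) / A) * (A * e) =
    (expR `|m| * e) * Num.sqrt (S + d ^+ 2) by field; rewrite gt_eqF.
have g1 : 1 <= expR `|m| * e.
  by rewrite -ler_pdivrMr// mul1r.
have g2 : e <= expR `|m| * e by rewrite ler_peMl// ltW.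
set k := _ * e in g1 g2 *.
have k0 : 0 <= k by rewrite (le_trans _ g1).
rewrite -[X in _ <= X * _](ger0_norm k0) -sqrtr_sqr -sqrtrM ?sqr_ge0//.
apply: ler_wsqrtr; rewrite mulrDr exprMn; apply: lerD.
  by rewrite ler_peMl// exprn_ege1.
by rewrite ler_wpM2r ?sqr_ge0// lerXn2r// ?nnegrE// ltW.
Qed.

(** Multiply the height of a path that ends at [x] by e^(m (1 - t)): the end point
    is kept, the starting point moves vertically, and the length changes in a
    controlled way.  This yields continuity of the distance along vertical lines
    without joining paths smoothly. *)
Lemma hdist_vertical x w h m : halfspace R n x -> 0 < h ->
  hdist (set_ends x w (h * expR m)) x <= expR `|m| * hdist (set_ends x w h) x + `|m|.
Proof.
move=> Hx h0; rewrite -lerBlDr -ler_pdivrMl ?expR_gt0//.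
apply: hdist_ge => //; first exact: set_ends_halfspace.
move=> c hc; rewrite ler_pdivrMl ?expR_gt0// lerBlDr.
case: (hc) => dc _ cH c0 c1.
pose E t := expR (m * (1 - t)).
have E0 t : 0 < E t by exact: expR_gt0.
have EE t : E t = expR m * expR (- m * t).
  by rewrite -expRD /E; congr expR; ring.
have dE t : is_derive t (1 : R) E (- m * E t).
  rewrite (_ : E = (fun t => expR m * expR (- m * t))); last exact/funext.
  rewrite mulrCA; have := is_derive_expM (- m) t => ?.
  by apply: (@is_derive_eq _ _ _ (expR m \*: (fun t => expR (- m * t)))).
have cE : continuous E.
  move=> t; apply: differentiable_continuous; apply/derivable1_diffP.
  by have [] := dE t.
pose a i t := c t 0 i; pose da (i : 'I_n.+1) t := 'D_1 c t 0 i.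
have dda i t : is_derive t (1 : R) (a i) (da i t) by exact: path_coord.
have ca i : continuous (a i) by move=> t; exact: path_coord_cont hc _ _.
have cda i : continuous (da i) by move=> t; exact: path_dcoord_cont hc _ _.
pose g i t := if i == ord_max then a i t * E t else a i t.
pose dg (i : 'I_n.+1) t := if i == ord_max then E t * (da i t - m * a i t) else da i t.
have [|||hg Dg] := @hpath_coords R n g dg.
- move=> i t; rewrite /g /dg; case: ifP => _; last exact: dda.
  apply: (@is_derive_eq _ _ _ (a i * E)).
  by rewrite /GRing.scale/=; ring.
- move=> i; rewrite /dg; case: (i == ord_max) => t; last exact: cda.
  apply: (@continuousM _ _ E) => //; first exact: cE.
  apply: (@continuousB _ _ _ (da i)); first exact: cda.
  by apply: cvgMl_tmp; exact: ca.
- by move=> t t01; rewrite /g eqxx mulr_gt0//; exact: cH.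
have e0 : \row_i g i 0 = set_ends x w (h * expR m).
  apply/rowP => i; rewrite !mxE /g /E subr0 mulr1 /a c0 mxE.
  by case: (i == ord_max).
have e1 : \row_i g i 1 = x.
  apply/rowP => i; rewrite !mxE /g /E subrr mulr0 expR0 mulr1 /a c1.
  by case: ifP.
rewrite e0 e1 in hg.
apply: (le_trans (hdist_le_length hg)).
have iS := speed_integrable hc.
have cc : lebesgue_measure.-integrable `[0, 1]%classic (EFin \o (cst `|m| : R -> R)).
  by apply: continuous_01_integrable => t _; exact: cst_continuous.
have cS : lebesgue_measure.-integrable `[0, 1]%classic
    (EFin \o (fun t => expR `|m| * hnorm (c t) ('D_1 c t))).
  apply: continuous_01_integrable => t t01.
  by apply: cvgMl_tmp; exact: speed_cont hc _ t01.
have -> : expR `|m| * hyp_length c + `|m| =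
  \int[lebesgue_measure]_(t in `[0, 1]%classic) (expR `|m| * hnorm (c t) ('D_1 c t) + cst `|m| t).
  rewrite RintegralD// RintegralZl//; congr (_ + _).
  have dK t : 0 <= t <= 1 -> is_derive t (1 : R) (fun t => `|m| * t) (cst `|m| t).
    by move=> _; apply: (@is_derive_eq _ _ _ (`|m| \*: (@id R))); exact: mulr1.
  have cK t : 0 <= t <= 1 -> {for t, continuous (cst `|m| : R -> R)}.
    by move=> _; exact: cst_continuous.
  by rewrite (Rintegral_derive dK cK) mulr1 mulr0 subr0.
rewrite /hyp_length; apply: le_Rintegral.
- exact: measurable_itv.
- exact: speed_integrable hg.
- apply: continuous_01_integrable => t t01.
  apply: (@continuousD _ _ _ (fun t => expR `|m| * hnorm (c t) ('D_1 c t))).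
    by apply: cvgMl_tmp; exact: speed_cont hc _ t01.
  exact: cst_continuous.
move=> t; rewrite /= in_itv/= => t01.
rewrite [leRHS]/(_ + `|m|).
have at0 : 0 < a ord_max t := cH t t01.
rewrite hnormE_abs Dg mxE /g eqxx hnormE; last exact: cH.
have sumE f : \sum_(i < n.+1) f i ^+ 2 = \sum_(i < n.+1 | i != ord_max) f i ^+ 2 + f ord_max ^+ 2 :> R.
  by rewrite (bigD1 ord_max)//= addrC.
rewrite (sumE (fun i => _ 0 i)) [in leRHS](sumE (fun i => _ 0 i)).
rewrite (eq_bigr (fun i => da i t ^+ 2)); last first.
  by move=> i /negbTE iN; rewrite mxE /dg iN.
rewrite !mxE /dg eqxx -!/(da _ t) -/(a ord_max t).
set S := \sum_(i < n.+1 | _) _.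
have S0 : 0 <= S by apply: sumr_ge0 => i _; exact: sqr_ge0.
have aE : 0 < a ord_max t * E t by rewrite mulr_gt0.
rewrite (gtr0_norm aE).
apply: scaled_speed_le => //.
- rewrite ler_expR; case/andP: t01 => t0 t1.
  rewrite (le_trans (ler_norm _))// normrM ler_piMr// ger0_norm ?subr_ge0//.
  by rewrite gerBl.
- rewrite -expRN ler_expR; case/andP: t01 => t0 t1.
  rewrite (le_trans (ler_norm _))// normrN normrM ler_piMr// ger0_norm ?subr_ge0//.
  by rewrite gerBl.
Qed.

End upper.

(** * Level sets of the weight *)

Section levels.
Context {R : realType} {n : nat}.
Implicit Types (x y z v : 'rV[R]_n.+1) (t : R).
Hypothesis n0 : (0 < n)%N.

Lemma weight_set_ends x w h : weight (set_ends x w h) = h ^+ 2 / (w ^+ 2 + h ^+ 2).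
Proof. by rewrite /weight /rho2 set_ends_max (set_ends_0 n0). Qed.

Lemma weight_gt0_le1 x : halfspace R n x -> 0 < weight x <= 1.
Proof.
move=> Hx; have r0 := rho2_gt0 Hx; apply/andP; split.
  by rewrite divr_gt0// exprn_gt0.
by rewrite ler_pdivrMr// mul1r lerDr sqr_ge0.
Qed.

Lemma hmeasurable_weight : hmeasurable (@weight R n).
Proof.
apply: measurable_funTS.
have m1 i : measurable_fun [set: n.+1.-tuple (measurableTypeR R)]
    (fun t : n.+1.-tuple (measurableTypeR R) => (row_of_tuple t) 0 i).
  by apply: (measurable_comp_row (g := fun x => x 0 i)); exact: coord_continuous.
have mr : measurable_fun [set: n.+1.-tuple (measurableTypeR R)]
    (fun t : n.+1.-tuple (measurableTypeR R) => rho2 (row_of_tuple t)).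
  by apply: (measurable_comp_row (g := rho2)) => x; exact: cont_rho2.
have -> : (fun t : n.+1.-tuple (measurableTypeR R) => weight (row_of_tuple t)) =
  (fun t : n.+1.-tuple (measurableTypeR R) => (row_of_tuple t) 0 ord_max ^+ 2 * (rho2 (row_of_tuple t)) `^ (-1)).
  apply/funext => t; rewrite /weight powR_inv1// addr_ge0 ?sqr_ge0//.
apply: measurable_funM; first exact: measurable_funX.
apply: (@measurableT_comp _ _ _ _ _ _ (fun z : R => z `^ (-1))) => //.
Qed.

Lemma hdist_set_ends_ge x w h : halfspace R n x -> 0 < h ->
  `|ln (x 0 ord_max) - ln h| <= hdist (set_ends x w h) x.
Proof.
by move=> Hx h0; have := hdist_ge_ln (set_ends_halfspace x w h0) Hx; rewrite set_ends_max.
Qed.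

Lemma cone_slope (al : R) : 0 < al <= 1 ->
  exists2 s : R, 0 <= s & forall x h, 0 < h -> weight (set_ends x (s * h) h) = al.
Proof.
case/andP=> a0 a1; exists (Num.sqrt (al^-1 - 1)); first exact: sqrtr_ge0.
move=> x h h0; rewrite weight_set_ends exprMn sqr_sqrtr; last by rewrite subr_ge0 invf_ge1.
have -> : (al^-1 - 1) * h ^+ 2 + h ^+ 2 = h ^+ 2 / al by ring.
by rewrite invf_div mulrC divfK// gt_eqF// exprn_gt0.
Qed.

Lemma cone_unbounded (al : R) : 0 < al <= 1 ->
  hunbounded [set x | halfspace R n x /\ weight x = al].
Proof.
move=> al01 x r Hx; have [s s0 sE] := cone_slope al01.
have y0 : 0 < x 0 ord_max := Hx.
pose h := x 0 ord_max * expR `|r|; have h0 : 0 < h by rewrite mulr_gt0 ?expR_gt0.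
have Uh : [set x | halfspace R n x /\ weight x = al] (set_ends x (s * h) h).
  by split; [exact: set_ends_halfspace|exact: sE].
move=> /(_ _ Uh)[_]; apply/negP; rewrite -leNgt.
apply: le_trans (hdist_set_ends_ge _ Hx h0).
rewrite lnM ?posrE ?expR_gt0// expRK opprD addrA subrr sub0r normrN normr_id.
exact: ler_norm.
Qed.

Lemma cone_shells (al : R) x : 0 < al <= 1 -> halfspace R n x ->
  \forall r \near +oo, [set x | halfspace R n x /\ weight x = al] `&`
     (hball x (2 * r) `\` hball x r) !=set0.
Proof.
move=> al01 Hx; have [s s0 sE] := cone_slope al01.
have y0 : 0 < x 0 ord_max := Hx.
set y := x 0 ord_max in y0.
(* bounds the horizontal part of the estimate in [hdist_parabola] *)
pose B := 2 * (`|x 0 ord0| / y + s).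
have B0 : 0 <= B by rewrite mulr_ge0// addr_ge0// divr_ge0// ltW.
near=> r.
have rB : B < r by near: r; by apply: nbhs_pinfty_gt; rewrite num_real.
have r0 : 0 < r by rewrite (le_lt_trans B0).
pose h := y * expR r; have h0 : 0 < h by rewrite mulr_gt0 ?expR_gt0.
have lnh : ln y - ln h = - r.
  by rewrite lnM ?posrE ?expR_gt0// expRK opprD addrA subrr sub0r.
have hy : y < h by rewrite ltr_pMr// -expR0 ltr_expR.
exists (set_ends x (s * h) h); split; first by split; [exact: set_ends_halfspace|exact: sE].
split.
  split; first exact: set_ends_halfspace.
  apply: (le_lt_trans (hdist_parabola n0 _ Hx h0 _)); first by rewrite gt_eqF.
  rewrite lnh normrN gtr0_norm// -ltrBrDl; have -> : 2 * r - r = r by ring.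
  apply: le_lt_trans rB; rewrite ler_pdivrMr ?addr_gt0// -/y /B.
  have D1 : `|x 0 ord0 - s * h| <= `|x 0 ord0| + s * h.
    by rewrite (le_trans (ler_normB _ _))// [X in _ + X]ger0_norm// mulr_ge0// ltW.
  have e1 : `|x 0 ord0| <= `|x 0 ord0| / y * (h + y).
    by rewrite mulrDr divfK ?gt_eqF// lerDr mulr_ge0 ?divr_ge0// ltW.
  have e2 : s * h <= s * (h + y) by rewrite ler_wpM2l// lerDl ltW.
  rewrite -mulrA ler_wpM2l// mulrDl; lra.
case=> _; apply/negP; rewrite -leNgt.
by apply: le_trans (hdist_set_ends_ge _ Hx h0); rewrite lnh normrN ler_norm.
Unshelve. all: by end_near. Qed.

Lemma hdist_vertical_cont x w (k : R) : halfspace R n x -> 0 < k ->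
  continuous (fun t : R => hdist (set_ends x w (k * expR t)) x).
Proof.
move=> Hx k0 t; set f := fun t => _.
(* exchanging a and b also bounds f b from below *)
have key a b : f b <= expR `|b - a| * f a + `|b - a|.
  have := @hdist_vertical _ _ x w (k * expR a) (b - a) Hx.
  rewrite mulr_gt0 ?expR_gt0// => /(_ isT).
  by rewrite -mulrA -expRD subrKC.
have cn : continuous (fun b : R => `|b - t|).
  by move=> b; apply: cvg_norm; apply: cvgB; [exact: cvg_id|exact: cvg_cst].
have ce (e : R) : continuous (fun b : R => expR (e * `|b - t|)).
  move=> b; have c1 : {for b, continuous (fun b : R => e * `|b - t|)}.
    by apply: cvgMl_tmp; exact: cn.
  exact: (continuous_at_comp c1 (@continuous_expR R _)).
pose lo b := expR (- 1 * `|b - t|) * (f t - `|b - t|).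
pose hi b := expR (1 * `|b - t|) * f t + `|b - t|.
have H : \forall b \near t, lo b <= f b <= hi b.
  near=> b; rewrite /hi mul1r key andbT /lo mulN1r expRN ler_pdivrMl ?expR_gt0//.
  by rewrite lerBlDr -[`|b - t|]distrC; exact: key.
have lo1 : lo b @[b --> t] --> f t.
  rewrite (_ : f t = lo t); last by rewrite /lo subrr normr0 mulr0 expR0 mul1r subr0.
  apply: cvgM; first exact: ce.
  by apply: cvgB; [exact: cvg_cst|exact: cn].
have hi1 : hi b @[b --> t] --> f t.
  rewrite (_ : f t = hi t); last by rewrite /hi subrr normr0 mulr0 expR0 mul1r addr0.
  apply: cvgD; last exact: cn.
  by apply: cvgM; [exact: ce|exact: cvg_cst].
exact: squeeze_cvgr H _ lo1 hi1.
Unshelve. all: by end_near. Qed.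

(** The intermediate value theorem on the vertical line with first coordinate [L],
    parametrised by the logarithm of the height relative to [x]. *)
Lemma level_on_vertical x (L v : R) : halfspace R n x -> 1 <= L -> 0 < v ->
  exists2 h, 0 < h & weight (set_ends x L h) * expR (hdist (set_ends x L h) x / 2) = v.
Proof.
move=> Hx L1 v0; have y0 : 0 < x 0 ord_max := Hx.
set y := x 0 ord_max in y0.
have L0 : 0 < L by rewrite (lt_le_trans _ L1).
pose g t := weight (set_ends x L (y * expR t)) * expR (hdist (set_ends x L (y * expR t)) x / 2).
have h0 t : 0 < y * expR t by rewrite mulr_gt0 ?expR_gt0.
have lnh t : ln y - ln (y * expR t) = - t.
  by rewrite lnM ?posrE ?expR_gt0// expRK opprD addrA subrr sub0r.
have cg : continuous g.
  move=> t; apply: (@continuousM _ _ (fun t => weight (set_ends x L (y * expR t)))).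
    rewrite (_ : (fun t => _) = fun t => (y * expR t) ^+ 2 * (L ^+ 2 + (y * expR t) ^+ 2)^-1);
      last by apply/funext => s; rewrite weight_set_ends.
    have c1 : {for t, continuous (fun t => (y * expR t) ^+ 2)}.
      by apply: continuous_at_sqr; apply: cvgMl_tmp; exact: continuous_expR.
    apply: (@continuousM _ _ (fun t => (y * expR t) ^+ 2)) => //.
    apply: (@continuousV _ _ (fun t => L ^+ 2 + (y * expR t) ^+ 2)).
      by rewrite gt_eqF// ltr_pwDl ?exprn_gt0// sqr_ge0.
    by apply: (@continuousD _ _ _ (cst (L ^+ 2))) => //; exact: cst_continuous.
  apply: (@continuous_at_comp _ _ _ (@expR R)); last exact: continuous_expR.
  apply: (@continuousM _ _ (fun t => hdist (set_ends x L (y * expR t)) x)).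
    exact: hdist_vertical_cont.
  exact: cst_continuous.
pose A := 2 * `|x 0 ord0 - L| / y.
pose B := v / (y ^+ 2 * expR (A / 2)).
have B0 : 0 < B by rewrite divr_gt0// mulr_gt0 ?expR_gt0// exprn_gt0.
(* at height y e^(- m) the value is at most (v / B) e^(- 3 m / 2) *)
pose m := `|ln B| + 1; have m0 : 0 < m by rewrite ltr_wpDl.
have low : g (- m) <= v.
  have d1 : hdist (set_ends x L (y * expR (- m))) x <= m + A.
    apply: (le_trans (hdist_parabola n0 _ Hx (h0 _) _)).
      by rewrite -/y lt_eqF// gtr_pMr// expR_lt1 oppr_lt0.
    rewrite lnh opprK gtr0_norm// lerD2l /A ler_wpM2l ?mulr_ge0//.
    by rewrite lef_pV2 ?posrE ?addr_gt0// lerDr ltW.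
  have V1 : weight (set_ends x L (y * expR (- m))) <= (y * expR (- m)) ^+ 2.
    rewrite weight_set_ends ler_pdivrMr; last by rewrite ltr_pwDl ?exprn_gt0// sqr_ge0.
    rewrite ler_peMr ?sqr_ge0//; have := sqr_ge0 (y * expR (- m)).
    have : 1 <= L ^+ 2 by rewrite exprn_ege1.
    lra.
  rewrite /g; apply: (@le_trans _ _ ((y * expR (- m)) ^+ 2 * expR ((m + A) / 2))).
    apply: ler_pM => //; first by have /andP[/ltW] := weight_gt0_le1 (set_ends_halfspace x L (h0 (- m))).
    by rewrite ler_expR ler_pM2r.
  have -> : (y * expR (- m)) ^+ 2 * expR ((m + A) / 2) =
     y ^+ 2 * expR (A / 2) * expR (- m - m / 2).
    rewrite exprMn -mulrA -expRM_natl -mulrA -!expRD; congr (_ * expR _); by field.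
  rewrite -ler_pdivlMl ?mulr_gt0 ?exprn_gt0 ?expR_gt0// [leRHS]mulrC -/B.
  rewrite -[leRHS]lnK ?posrE// ler_expR.
  have := ler_norm (- ln B); have := normr_ge0 (ln B); rewrite normrN /m; lra.
(* the first term makes the weight at least 1/2, the second makes the
   exponential at least 2 v *)
pose M := `|ln (L / y)| + 2 * `|ln (2 * v)|.
have M0 : 0 <= M by rewrite addr_ge0// mulr_ge0.
have high : v <= g M.
  have hL : L <= y * expR M.
    rewrite mulrC -ler_pdivrMr// -[leLHS]lnK ?posrE ?divr_gt0// ler_expR.
    have := ler_norm (ln (L / y)); have := normr_ge0 (ln (2 * v)); rewrite /M; lra.
  have V2 : 2^-1 <= weight (set_ends x L (y * expR M)).
    rewrite weight_set_ends ler_pdivlMr; last by rewrite ltr_pwDl ?exprn_gt0// sqr_ge0.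
    have : L ^+ 2 <= (y * expR M) ^+ 2 by rewrite lerXn2r// nnegrE ltW.
    lra.
  have d2 : M <= hdist (set_ends x L (y * expR M)) x.
    by apply: le_trans (hdist_set_ends_ge _ Hx (h0 M)); rewrite lnh normrN ler_norm.
  apply: (@le_trans _ _ (2^-1 * expR (M / 2))).
    rewrite ler_pdivlMl// -[leLHS]lnK ?posrE ?mulr_gt0// ler_expR.
    have := ler_norm (ln (2 * v)); have := normr_ge0 (ln (L / y)); rewrite /M; lra.
  by apply: ler_pM => //; rewrite ?expR_ge0// ler_expR ler_pM2r.
have mM : - m <= M by rewrite (le_trans _ M0)// oppr_le0 ltW.
have [||c _ gc] := @IVT R g (- m) M v mM.
- exact: continuous_subspaceT.
- apply/andP; split.
    by rewrite ge_min; apply/orP; left.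
  by rewrite le_max; apply/orP; right.
by exists (y * expR c).
Qed.

(** The points provided by [level_on_vertical] have first coordinate as large as
    desired, and log (1 + rho^2) then bounds their distance from below. *)
Lemma level_unbounded x0 (v : R) : halfspace R n x0 -> 0 < v ->
  hunbounded [set x | halfspace R n x /\ weight x * expR (hdist x x0 / 2) = v].
Proof.
move=> Hx0 v0 x r Hx.
(* then 1 + Q^2 >= (1 + rho2 x) e^(2 |r|), as Q >= 1 *)
pose Q := (1 + rho2 x) * expR (2 * `|r|).
have r1 : 1 <= 1 + rho2 x by rewrite lerDl addr_ge0 ?sqr_ge0.
have r10 : 0 < 1 + rho2 x by rewrite (lt_le_trans _ r1).
have Q1 : 1 <= Q.
  by rewrite /Q mulr_ege1// -expR0 ler_expR mulr_ge0.
have [h h0 hE] := level_on_vertical Hx0 Q1 v0.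
have Wh : [set x | halfspace R n x /\ weight x * expR (hdist x x0 / 2) = v] (set_ends x0 Q h).
  by split => //; exact: set_ends_halfspace.
move=> /(_ _ Wh)[_]; apply/negP; rewrite -leNgt.
apply: (le_trans (ler_norm r)).
rewrite -(ler_pM2l (ltr0n R 2)).
have Hp := set_ends_halfspace x0 Q h0.
apply: (le_trans _ (hdist_ge_rho2 n0 Hp Hx)).
rewrite distrC; apply: (le_trans _ (ler_norm _)).
rewrite lerBrDl -ler_expR expRD !lnK ?posrE//; last first.
  by rewrite ltr_pwDl// addr_ge0 ?sqr_ge0.
apply: (@le_trans _ _ Q) => //.
rewrite /rho2 set_ends_max (set_ends_0 n0).
have := ler_peMl (ltW (lt_le_trans ltr01 Q1)) Q1; rewrite -expr2.
have := sqr_ge0 h; lra.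
Qed.
End levels.

(** * The theorem *)

Unset Implicit Arguments.
Theorem theorem2p2 (R : realType) (p : R) (n : nat) (hp : 1 < p)
    (hN : (2 <= n.+1)%N) :
  let N : R := n.+1%:R in
  let p' := p / (p - 1) in
  let Lambda := ((N - 1) / p) `^ p in
  exists (V : 'rV[R]_n.+1 -> R) (C : R),
    [/\ hmeasurable V /\ (forall x, halfspace R n x -> 0 < V x <= 1),
        0 < C,
        forall u : 'rV[R]_n.+1 -> R, hsmooth u -> hcompact_support u ->
          ((((N - 1) / p) `^ (p - 2) * C)%R%:E
              * hintegral (fun x => (V x * `|u x| `^ p)%R)
           <= hintegral (fun x => (hnorm x (hgrad u x) `^ p)%R)
              - Lambda%:E * hintegral (fun x => (`|u x| `^ p)%R))%E,
        [/\ 1 < p <= 4 / 3 -> (4 * p')^-1 <= C,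
            4 / 3 < p <= 2 ->
              (2 * (8 - 3 * p) + 2 * Num.sqrt (p' * (8 - 3 * p)))^-1 <= C,
            2 < p <= 2 * (N - 1) ^+ 2 ->
              C = (Num.sqrt 2)^-1 * (Num.sqrt 2 * p + 2 * Num.sqrt p)^-1
          & 2 * (N - 1) ^+ 2 < p ->
              C = (p / (N - 1) + 2 * p + 2 * (N - 1))^-1]
      & forall x0, halfspace R n x0 ->
          (forall alpha : R, 0 < alpha <= 1 ->
            exists U : set 'rV[R]_n.+1,
              [/\ U `<=` halfspace R n, hunbounded U,
                  (forall x, U x -> V x = alpha)
                & \forall r \near +oo,
                    U `&` (hball x0 (2 * r) `\` hball x0 r) !=set0])
          /\
          (forall beta : R, 0 < beta ->
            exists W : set 'rV[R]_n.+1,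
              [/\ W `<=` halfspace R n, hunbounded W
                & forall e : R, 0 < e -> \forall r \near +oo,
                    forall x, W x -> r < hdist x x0 ->
                      `|V x * expR (hdist x x0 / 2) - Num.sqrt (beta / 2)|
                        < e])].
Proof.
move=> N p' Lambda.
have n0 : (0 < n)%N by [].
have NE : N - 1 = n%:R by rewrite /N -natr1 addrK.
have N1 : 1 < N by rewrite /N ltr1n.
have /andP[C0 CC] := Cnp_bounds N1 hp.
exists weight, (Cnp N p); split => //.
- split; first exact: hmeasurable_weight.
  by move=> x; exact: weight_gt0_le1.
- move=> u su [K [cK KH u0]]; rewrite /Lambda NE.
  exact: (weighted_poincare su cK KH u0 hp n0 CC).
- rewrite /Cnp; split.
  + by move=> /andP[_ ->].
  + move=> /andP[p43 p2].
    by rewrite [p <= 4 / 3]leNgt p43 /= p2.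
  + move=> /andP[p2 pN].
    have p43 : 4 / 3 < p by lra.
    by rewrite [p <= 4 / 3]leNgt [p <= 2]leNgt p43 p2 /= pN.
  + move=> pN.
    have p2 : 2 < p.
      apply: le_lt_trans pN; rewrite ler_peMr// exprn_ege1// NE ler1n.
      exact: n0.
    have p43 : 4 / 3 < p by lra.
    by rewrite [p <= 4 / 3]leNgt [p <= 2]leNgt [p <= 2 * _]leNgt p43 p2 pN.
- move=> x0 Hx0; split.
  + move=> al al01; exists [set x | halfspace R n x /\ weight x = al]; split.
    * by move=> x [].
    * exact: cone_unbounded.
    * by move=> x [].
    * exact: cone_shells.
  + move=> be be0.
    have s0 : 0 < Num.sqrt (be / 2) by rewrite sqrtr_gt0 divr_gt0.
    exists [set x | halfspace R n x /\
      weight x * expR (hdist x x0 / 2) = Num.sqrt (be / 2)]; split.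
    * by move=> x [].
    * exact: level_unbounded.
    * move=> e e0; near=> r => x [_ ->] _.
      by rewrite subrr normr0.
Unshelve. all: by end_near. Qed.
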